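(* Let $G=SL_2(\mathbb{Z})$, let $G\curvearrowright(Y,\nu)=(\mathbb{T}^G,\mu_0^G)$ be the Bernoulli shift, and let $G\curvearrowright(X,\mu)=(\mathbb{T}^2,\mu)$ be the standard action (by automorphisms of the torus), with $\mu$ the Haar measure. Let $G\curvearrowright(Q,\eta)$ be an intermediate factor between the diagonal action $G\curvearrowright(Y,\nu)\times(X,\mu)$ and $G\curvearrowright(Y,\nu)$. Then there exists a factor map of $G$-actions $(X,\mu)\to(Z,\zeta)$ such that $G\curvearrowright(Q,\eta)$ is measurably conjugate to the diagonal action $G\curvearrowright(Y,\nu)\times(Z,\zeta)$.
   Context: $\mu_0$ is the Haar (Lebesgue) probability measure on the circle $\mathbb{T}$, $\mu_0^G$ the product measure on $\mathbb{T}^G$, and the Bernoulli shift is $(g y)_h=y_{g^{-1}h}$. An intermediate factor $(Q,\eta)$ between $(Y,\nu)\times(X,\mu)$ and $(Y,\nu)$ is a probability measure-preserving $G$-action together with $G$-equivariant measure-preserving maps $(Y\times X,\nu\times\mu)\to(Q,\eta)\to(Y,\nu)$ whose composition is the coordinate projection to $Y$.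
   Formalization: The intermediate factor Q is assumed to be a standard Borel space (the usual convention for pmp actions); without it, point conjugacy fails, e.g. for Q = Y×X×{0,1} with the indiscrete sigma-algebra on {0,1}. The factor Z obtained is also standard Borel. *)

(* Defs.v *)
From HB Require Import structures.
From mathcomp Require Import all_boot all_order all_algebra.
From mathcomp Require Import archimedean ring_quotient generic_quotient.
From mathcomp Require Import all_classical all_reals all_analysis.

Set Implicit Arguments.
Unset Strict Implicit.
Unset Printing Implicit Defensive.

Import Order.TTheory GRing.Theory Num.Theory.
Import numFieldNormedType.Exports.

Local Open Scope classical_set_scope.
Local Open Scope ring_scope.
Local Open Scope quotient_scope.

Record SL2Z := MkSL2Z { SL2Z_mx :> 'M[int]_2; SL2Z_det : \det SL2Z_mx == 1 }.

HB.instance Definition _ := [isSub for SL2Z_mx].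
HB.instance Definition _ := [Countable of SL2Z by <:].

Section SL2Z_group.
Implicit Types g h : SL2Z.

Fact SL2Z_one_det : \det (1%:M : 'M[int]_2) == 1.
Proof. by rewrite det1. Qed.

Fact SL2Z_mul_det g h : \det (g *m h) == 1.
Proof. by rewrite det_mulmx (eqP (SL2Z_det g)) (eqP (SL2Z_det h)) mulr1. Qed.

Fact SL2Z_unit g : (g : 'M[int]_2) \in unitmx.
Proof. by rewrite unitmxE (eqP (SL2Z_det g)) unitr1. Qed.

Fact SL2Z_inv_det g : \det (invmx g) == 1.
Proof. by rewrite det_inv (eqP (SL2Z_det g)) invr1. Qed.

Definition SL2Z_one := MkSL2Z SL2Z_one_det.
Definition SL2Z_mul g h := MkSL2Z (SL2Z_mul_det g h).
Definition SL2Z_inv g := MkSL2Z (SL2Z_inv_det g).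

Fact SL2Z_mulA : associative SL2Z_mul.
Proof. by move=> f g h; apply: val_inj; rewrite /= mulmxA. Qed.

Fact SL2Z_mul1 : left_id SL2Z_one SL2Z_mul.
Proof. by move=> g; apply: val_inj; rewrite /= mul1mx. Qed.

Fact SL2Z_mulr1 : right_id SL2Z_one SL2Z_mul.
Proof. by move=> g; apply: val_inj; rewrite /= mulmx1. Qed.

Fact SL2Z_mulV : left_inverse SL2Z_one SL2Z_inv SL2Z_mul.
Proof. by move=> g; apply: val_inj; rewrite /= mulVmx // SL2Z_unit. Qed.

Fact SL2Z_mulrV : right_inverse SL2Z_one SL2Z_inv SL2Z_mul.
Proof. by move=> g; apply: val_inj; rewrite /= mulmxV // SL2Z_unit. Qed.

HB.instance Definition _ := isGroup.Build SL2Z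
  SL2Z_mulA SL2Z_mul1 SL2Z_mulr1 SL2Z_mulV SL2Z_mulrV.

End SL2Z_group.

(* [x \in integers R] unfolds to [x \is a Num.int]. *)
Definition integers (R : realType) : zmodClosed R :=
  GRing.ZmodClosed.clone R Num.int_num_subdef _.

Definition circle (R : realType) : Type := Quotient.quot (integers R).

Fact circle_display : measure_display. Proof. by []. Qed.

Section circle.
Variable R : realType.

HB.instance Definition _ := GRing.Zmodule.on (circle R).
HB.instance Definition _ := isPointed.Build (circle R) 0.

Definition circle_pi (x : R) : circle R := \pi_(Quotient.quot (integers R)) x.

(* The quotient sigma-algebra, which is the Borel sigma-algebra of R / Z. *)
Definition circle_measurable : set_system (circle R) :=
  [set A | measurable (circle_pi @^-1` A)].

Fact circle_measurable0 : circle_measurable set0.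
Proof. by rewrite /circle_measurable /= preimage_set0. Qed.

Fact circle_measurableC A : circle_measurable A -> circle_measurable (~` A).
Proof. by rewrite /circle_measurable /= preimage_setC; exact: measurableC. Qed.

Fact circle_measurable_bigcup (F : (set (circle R))^nat) :
  (forall i, circle_measurable (F i)) -> circle_measurable (\bigcup_i F i).
Proof.
move=> mF; rewrite /circle_measurable /= preimage_bigcup.
exact: bigcupT_measurable.
Qed.

HB.instance Definition _ := @isMeasurable.Build circle_display (circle R)
  circle_measurable circle_measurable0 circle_measurableC
  circle_measurable_bigcup.

Local Open Scope ereal_scope.

(* The image of Lebesgue measure on the fundamental domain [0, 1[. *)
Definition haar_circle (A : set (circle R)) : \bar R :=
  @lebesgue_measure R (`[0%R, 1%R[ `&` circle_pi @^-1` A).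

Fact haar_circle0 : haar_circle set0 = 0.
Proof. by rewrite /haar_circle preimage_set0 setI0 measure0. Qed.

Fact haar_circle_ge0 A : 0 <= haar_circle A.
Proof. exact: measure_ge0. Qed.

Fact haar_circle_sigma_additive : semi_sigma_additive haar_circle.
Proof.
move=> F mF tF mUF; rewrite /haar_circle preimage_bigcup setI_bigcupr.
apply: measure_semi_sigma_additive.
- by move=> n; apply: measurableI => //; exact: mF.
- apply/trivIsetP => i j _ _ ij; rewrite setIACA setIid -preimage_setI.
  by move/trivIsetP : tF => /(_ _ _ I I ij) ->; rewrite preimage_set0 setI0.
- by apply: bigcup_measurable => n _; apply: measurableI => //; exact: mF.
Qed.

HB.instance Definition _ := isMeasure.Build _ _ _ haar_circle
  haar_circle0 haar_circle_ge0 haar_circle_sigma_additive.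

Fact haar_circleT : haar_circle setT = 1.
Proof.
by rewrite /haar_circle preimage_setT setIT lebesgue_measure_itv /= lte01 oppr0 adde0.
Qed.

HB.instance Definition _ := Measure_isProbability.Build _ _ _ haar_circle
  haar_circleT.

End circle.

Definition cylinders (I : Type) d (T : measurableType d) : set_system (I -> T) :=
  [set A | exists i, exists2 B : set T, measurable B & A = [set y | B (y i)]].

Definition power_space (I : Type) d (T : measurableType d) :=
  g_sigma_algebraType (@cylinders I d T).

(* [nu] is the product measure mu^I: the (unique) probability on T^I whose
   finite-dimensional marginals are products of copies of [mu]. *)
Definition is_power_measure (I : choiceType) d (T : measurableType d)
    (R : realType) (mu : probability T R)
    (nu : probability (power_space I T) R) : Prop :=
  forall (s : seq I) (B : I -> set T),
    uniq s -> (forall i, measurable (B i)) ->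
    nu [set y : power_space I T | forall i, i \in s -> B i (y i)] =
      (\prod_(i <- s) mu (B i))%E.

Definition is_action (G : groupType) (T : Type) (a : G -> T -> T) : Prop :=
  (forall x, a 1%g x = x) /\ (forall g h x, a (g * h)%g x = a g (a h x)).

Section pmp.
Context (R : realType) (G : groupType).

Definition measure_preserving d (T : measurableType d) d' (U : measurableType d')
    (mu : probability T R) (nu : probability U R) (f : T -> U) : Prop :=
  measurable_fun setT f /\
  forall B : set U, measurable B -> mu (f @^-1` B) = nu B.

Definition pmp_action d (T : measurableType d) (mu : probability T R)
    (a : G -> T -> T) : Prop :=
  is_action a /\ forall g, measure_preserving mu mu (a g).

(* As usual in ergodic theory, identities between maps hold up to null sets. *)
Definition factor_map d (T : measurableType d) d' (U : measurableType d')
    (mu : probability T R) (a : G -> T -> T)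
    (nu : probability U R) (b : G -> U -> U) (f : T -> U) : Prop :=
  measure_preserving mu nu f /\
  forall g, {ae mu, forall x, f (a g x) = b g (f x)}.

Definition measurably_conjugate
    d (T : measurableType d) d' (U : measurableType d')
    (mu : probability T R) (a : G -> T -> T)
    (nu : probability U R) (b : G -> U -> U) : Prop :=
  exists (f : T -> U) (h : U -> T),
    [/\ factor_map mu a nu b f, factor_map nu b mu a h,
        {ae mu, forall x, h (f x) = x} & {ae nu, forall y, f (h y) = y}].

Definition diag_action (T U : Type) (a : G -> T -> T) (b : G -> U -> U)
    (g : G) (w : T * U) : T * U := (a g w.1, b g w.2).

Definition intermediate_factor
    d1 (Y : measurableType d1) d2 (X : measurableType d2)
    d3 (Q : measurableType d3)
    (nu : probability Y R) (a : G -> Y -> Y)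
    (mu : probability X R) (b : G -> X -> X)
    (eta : probability Q R) (c : G -> Q -> Q) : Prop :=
  pmp_action eta c /\
  exists (p : Y * X -> Q) (q : Q -> Y),
    [/\ factor_map (nu \x mu)%E (diag_action a b) eta c p,
        factor_map eta c nu a q &
        {ae (nu \x mu)%E, forall w, q (p w) = w.1}].

End pmp.

Definition polish (R : realType) (P : metricType R) : Prop :=
  (forall F : set_system P, ProperFilter F -> cauchy F -> exists x : P, F --> x)
  /\ exists2 D : set P, countable D & dense D.

Definition standard_borel (R : realType) d (T : measurableType d) : Prop :=
  exists (P : metricType R) (f : T -> P),
    [/\ polish P, bijective f &
        forall A : set T, measurable A <-> <<s @open P >> (f @` A)].

Definition bernoulli_shift (G : groupType) d (T : measurableType d)
    (g : G) (y : power_space G T) : power_space G T :=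
  fun h => y (g^-1 * h)%g.

Definition torus2 (R : realType) : Type := (circle R * circle R)%type.

HB.instance Definition _ (R : realType) :=
  Measurable.copy (torus2 R) (circle R * circle R)%type.

Definition haar_torus2 (R : realType) : probability (torus2 R) R :=
  (@haar_circle R \x @haar_circle R)%E.

(* Multiplication of the column vector (x.1, x.2) by the matrix [g]. *)
Definition torus2_action (R : realType) (g : SL2Z) (x : torus2 R) : torus2 R :=
  (x.1 *~ g 0 0 + x.2 *~ g 0 1, x.1 *~ g 1 0 + x.2 *~ g 1 1).

(* Main.v *)
(** An intermediate factor is an intermediate sigma-algebra between that of Y and
    that of Y * X; let E be the conditional expectation onto it.  Every character
    e_v of the torus is fixed by an infinite parabolic subgroup of SL_2(Z), so
    E(e_v) is invariant under this subgroup.  The Bernoulli shift is mixing, hence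
    an invariant function on Y * X depends on the X-coordinate only.  Characters
    being total, the intermediate sigma-algebra is generated by Y and by the
    functions E(e_v) on X, which G permutes up to null sets.  Their level sets
    define the factor Z, a space of 0-1 sequences on which G permutes the
    coordinates; standardness of Q turns the equality of sigma-algebras into a
    point map.  Real characters cos + sin are used in place of e_v. *)

Require Import Defs.
From HB Require Import structures.
From mathcomp Require Import all_boot all_order all_algebra.
From mathcomp Require Import archimedean ring_quotient generic_quotient.
From mathcomp Require Import all_classical all_reals all_analysis.
From mathcomp Require Import measurable_realfun lra ring.

Set Implicit Arguments.
Unset Strict Implicit.
Unset Printing Implicit Defensive.

Import Order.TTheory GRing.Theory Num.Theory.
Import numFieldNormedType.Exports.

Local Open Scope classical_set_scope.
Local Open Scope ring_scope.

(** * Functional monotone classes *)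

(** Identities that hold almost everywhere on Y * X must be brought down to X, Z or Q, which is
    possible only for measurable properties; this is where countable separation of the spaces is
    used. The subsets of X cut out by E(e_v) are determined only up to null sets, whereas G has to
    act on Z everywhere: the action is fixed in advance on all 0-1 sequences, and only the map from
    X is equivariant up to null sets. That Y and the E(e_v) generate the intermediate sigma-algebra
    holds for the following reason: for B in Q, the indicator 1_B and its conditional expectation
    onto Y * Z have the same integral against 1_C(y) e_v(x), since e_v may be replaced there by
    E(e_v), a function on Z; such products are total. Totality of characters, mixing and invariance
    of measures are all obtained by monotone classes of bounded functions, without Hilbert space
    theory: a property stable under linear combinations and bounded pointwise limits is checked on
    characters, cylinders or rectangles. *)

Section bounded_closed.
Context (R : realType) (T : Type).

(** Limits are uniformly bounded rather than monotone: this is the form of convergence under which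
    integrals pass to the limit, and polynomial approximations satisfy it. *)
Definition bclosed (L : set (T -> R)) :=
  (forall a f g, L f -> L g -> L (fun x => a * f x + g x)) /\
  (forall (F : nat -> T -> R) (f : T -> R) (M : R), (forall n, L (F n)) ->
     (forall n x, `|F n x| <= M) -> (forall x, F ^~ x @ \oo --> f x) -> L f).

Lemma bclosed_sum (L : set (T -> R)) (I : Type) (s : seq I) (f : I -> T -> R) :
  bclosed L -> L (fun=> 0) -> (forall i, L (f i)) ->
  L (fun x => \sum_(i <- s) f i x).
Proof.
move=> [L1 _] L0 Lf; elim: s => [|i s ih].
  by under eq_fun do rewrite big_nil.
under eq_fun do rewrite big_cons.
by have := L1 1 _ _ (Lf i) ih; under eq_fun do rewrite mul1r.
Qed.

End bounded_closed.

Section bounded_measurable.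
Context (R : realType) d (T : measurableType d).
Implicit Types f g : T -> R.

Definition bmfun f := measurable_fun setT f /\ exists M : R, forall x, `|f x| <= M.

Lemma bmfunZD a f g : bmfun f -> bmfun g -> bmfun (fun x => a * f x + g x).
Proof.
move=> [mf [M fM]] [mg [N gN]]; split.
  by apply: measurable_funD => //; exact: measurable_funM.
exists (`|a| * M + N) => x; rewrite (le_trans (ler_normD _ _))// lerD//.
by rewrite normrM ler_wpM2l.
Qed.

Lemma bmfunM f g : bmfun f -> bmfun g -> bmfun (fun x => f x * g x).
Proof.
move=> [mf [M fM]] [mg [N gN]]; split; first exact: measurable_funM.
by exists (M * N) => x; rewrite normrM ler_pM.
Qed.

Lemma bmfun_cst a : bmfun (fun=> a).
Proof. by split; [exact: measurable_cst|exists `|a|]. Qed.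

Lemma bmfunB f g : bmfun f -> bmfun g -> bmfun (fun x => f x - g x).
Proof.
move=> bf bg; have := bmfunZD (-1) bg bf.
by under eq_fun do rewrite mulN1r addrC.
Qed.

Lemma bmfun_norm f : bmfun f -> bmfun (fun x => `|f x|).
Proof.
by move=> [mf [M fM]]; split; [exact: measurableT_comp|exists M => x; rewrite normr_id].
Qed.

Lemma bmfun_indic (A : set T) : measurable A -> bmfun \1_A.
Proof.
move=> mA; split; first exact: measurable_indic.
by exists 1 => x; rewrite indicE; case: (_ \in _); rewrite ?normr1 ?normr0.
Qed.

Lemma bmfun_integrable (m : probability T R) f :
  bmfun f -> m.-integrable setT (EFin \o f).
Proof.
move=> [mf [M fM]]; apply: measurable_bounded_integrable => //.
- by rewrite (le_lt_trans (probability_le1 _ _))// ltry.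
- exists M; split; first exact: num_real.
  by move=> N MN x _ /=; rewrite (le_trans (fM x))// ltW.
Qed.

Lemma bmfun_lim (F : nat -> T -> R) (f : T -> R) (M : R) : (forall n, bmfun (F n)) ->
  (forall n x, `|F n x| <= M) -> (forall x, F ^~ x @ \oo --> f x) -> bmfun f.
Proof.
move=> bF FM Ff; split.
  by apply: (@measurable_fun_cvg _ _ _ _ F) => [n|x _]; [case: (bF n)|exact: Ff].
exists M => x; rewrite -(cvg_lim _ (cvg_norm (Ff x)))//.
by apply: limr_le; [apply/cvg_ex; eexists; exact: cvg_norm (Ff x)|exact: nearW].
Qed.

Lemma RintegralZD (m : probability T R) a f g : bmfun f -> bmfun g ->
  \int[m]_x (a * f x + g x) = a * \int[m]_x f x + \int[m]_x g x.
Proof.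
move=> bf bg; rewrite RintegralD//.
- by rewrite RintegralZl//; exact: bmfun_integrable.
- apply: bmfun_integrable; have := bmfunZD a bf (bmfun_cst 0).
  by under eq_fun do rewrite addr0.
- exact: bmfun_integrable.
Qed.

Lemma bounded_convergence (m : probability T R) (F : nat -> T -> R) (f : T -> R) (M : R) :
  (forall n, bmfun (F n)) ->
  (forall n x, `|F n x| <= M) -> (forall x, F ^~ x @ \oo --> f x) ->
  \int[m]_x F n x @[n --> \oo] --> \int[m]_x f x.
Proof.
move=> bF FM Ff; have bf := bmfun_lim bF FM Ff.
have [] := @dominated_convergence _ _ _ m setT measurableT
  (fun n => EFin \o F n) (EFin \o f) (cst M%:E).
- by move=> n; apply/measurable_EFinP; case: (bF n).
- by apply/measurable_EFinP; case: bf.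
- by apply: aeW => x _; apply: cvg_EFin; [exact: nearW|exact: Ff].
- exact: (bmfun_integrable m (bmfun_cst M)).
- by apply: aeW => x n _; rewrite /= lee_fin.
move=> _ _; rewrite -(@fineK _ (\int[m]_x (EFin \o f) x)); last first.
  exact: integrable_fin_num (bmfun_integrable m bf).
by move/fine_cvgP => [_].
Qed.

Lemma Rintegral_indic (m : probability T R) (A : set T) : measurable A ->
  \int[m]_x \1_A x = fine (m A).
Proof. by move=> mA; rewrite /Rintegral integral_indic// setIT. Qed.

Lemma Rintegral_cst_prob (m : probability T R) a : \int[m]_x a = a.
Proof.
transitivity (a * fine (m setT)); first exact: Rintegral_cst.
by rewrite probability_setT mulr1.
Qed.

(** Integration after a measurable change of variable and against a bounded weight has this form, so
    that one uniqueness principle serves for all integral identities below. *)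
Definition bfunctional (l : (T -> R) -> R) :=
  (forall a f g, bmfun f -> bmfun g ->
     l (fun x => a * f x + g x) = a * l f + l g) /\
  (forall (F : nat -> T -> R) (f : T -> R) (M : R), (forall n, bmfun (F n)) ->
     (forall n x, `|F n x| <= M) -> (forall x, F ^~ x @ \oo --> f x) ->
     l (F n) @[n --> \oo] --> l f).

Lemma bclosed_eq_bfunctional l l' : bfunctional l -> bfunctional l' ->
  bclosed [set f | bmfun f /\ l f = l' f].
Proof.
move=> [l1 l2] [l1' l2']; split.
  move=> a f g /= [bf lf] [bg lg]; split; first exact: bmfunZD.
  by rewrite l1// l1'// lf lg.
move=> F f M FL FM Ff; have bF n := (FL n).1.
split; first exact: bmfun_lim bF FM Ff.
apply/esym; have h := l2' F f M bF FM Ff.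
apply: cvg_unique h _ => //.
have -> : (fun n => l' (F n)) = (fun n => l (F n)).
  by apply/funext => n; case: (FL n) => _ ->.
exact: l2 bF FM Ff.
Qed.

(** Complements come from 1 - 1_S. For disjoint unions the partial sums of indicators take only the
    values 0 and 1, so they converge boundedly. *)
Lemma bclosed_dynkin (L : set (T -> R)) (G : set (set T)) :
  @measurable _ T = <<s G >> -> setI_closed G ->
  bclosed L -> L (fun=> 1) -> (forall A, G A -> L \1_A) ->
  forall A, measurable A -> L \1_A.
Proof.
move=> GE GI bL L1 LG A mA.
have L0 : L (fun=> 0).
  by have := bL.1 (-1) _ _ L1 L1; under eq_fun do rewrite mulr1 addNr.
have sA : <<s G >> A by rewrite -GE.
apply: (dynkin_induction (P := [set A | L \1_A]) GE GI _ _ _ _ sA) => //=.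
- by rewrite indicT.
- move=> S mS LS; have := bL.1 (-1) _ _ LS L1; congr L; apply/funext => x.
  by rewrite !indicE in_setC; case: (_ \in _) => /=; lra.
- move=> F mF tF LF.
  pose S n x : R := \sum_(i <- iota 0 n) \1_(F i) x.
  have S1 k x n : F k x -> S n x = (k < n)%N%:R.
    move=> Fkx; have E i : \1_(F i) x = (i == k)%:R :> R.
      have [->|ik] := eqVneq i k; first by rewrite indicE mem_set.
      rewrite indicE memNset// => Fix_.
      by move/trivIsetP : tF => /(_ i k I I ik); rewrite -subset0 => /(_ x); apply.
    rewrite /S; under eq_bigr do rewrite E.
    rewrite -natr_sum; congr (_%:R).
    rewrite (_ : \sum_(i <- iota 0 n) _ = count_mem k (iota 0 n)).
      by rewrite count_uniq_mem ?iota_uniq// mem_iota.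
    by elim: (iota 0 n) => [|i s ih]; rewrite ?big_nil// big_cons/= ih.
  have S0 x n : ~ (\bigcup_k F k) x -> S n x = 0.
    move=> Fx; rewrite /S big1// => i _; rewrite indicE memNset// => Fix_.
    by apply: Fx; exists i.
  apply: (bL.2 S _ 1).
  + by move=> n; exact: bclosed_sum.
  + move=> n x; have [[k _ Fkx]|Fx] := pselect ((\bigcup_k F k) x).
      by rewrite (S1 k)//; case: ltnP; rewrite ?normr1 ?normr0.
    by rewrite S0// normr0.
  + move=> x; have [[k _ Fkx]|Fx] := pselect ((\bigcup_k F k) x).
      rewrite indicE mem_set; last by exists k.
      apply: cvg_near_cst; exists k.+1 => // n /= kn.
      by rewrite (S1 k)// kn.
    rewrite indicE memNset//; apply: cvg_near_cst; apply: nearW => n.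
    exact: S0.
Qed.

Import HBNNSimple.

Lemma bclosed_bmfun (L : set (T -> R)) : bclosed L ->
  (forall A, measurable A -> L \1_A) -> forall f, bmfun f -> L f.
Proof.
move=> bL Li f bf.
have L1 : L (fun=> 1) by have := Li _ measurableT; rewrite indicT.
have L0 : L (fun=> 0).
  by have := Li _ measurable0; rewrite indic0.
have Lcst a : L (fun=> a).
  by have := bL.1 a _ _ L1 L0; under eq_fun do rewrite mulr1 addr0.
(* Adding its bound makes f nonnegative; the simple approximations from below are then bounded by
   the bound of f. *)
wlog f0 : f bf / forall x, 0 <= f x.
  move=> h; case: (bf) => _ [M fM].
  have /h : bmfun (fun x => 1 * f x + M) by apply: bmfunZD => //; exact: bmfun_cst.
  have fM0 x : 0 <= 1 * f x + M.
    by have := fM x; rewrite ler_norml => /andP[]; lra.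
  move=> /(_ fM0) LM; have := bL.1 1 _ _ LM (Lcst (- M)); congr L.
  by apply/funext => x; lra.
case: (bf) => mf [M fM].
have mEf : measurable_fun setT (EFin \o f) by apply/measurable_EFinP.
pose F := nnsfun_approx measurableT mEf.
have f0E x : setT x -> (0 <= (EFin \o f) x)%E by rewrite /= lee_fin.
have Ff n x : F n x <= f x.
  rewrite -lee_fin nnsfun_approxE; exact: (le_approx n f0E).
apply: (bL.2 (fun n => F n) _ M).
- move=> n; have -> : (F n : T -> R) =
      (fun x => \sum_(r <- finmap.enum_fset (fset_set (range (F n)))) r * \1_(F n @^-1` [set r]) x).
    apply/funext => x; rewrite fimfunE fsbig_finite//=.
  apply: bclosed_sum => // r.
  by have := bL.1 r _ _ (Li (F n @^-1` [set r]) _) L0 ; under eq_fun do rewrite addr0; apply.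
- move=> n x; rewrite ger0_norm// (le_trans (Ff n x))//.
  by rewrite (le_trans (ler_norm _)).
- move=> x; have := @cvg_nnsfun_approx _ _ _ _ measurableT _ mEf f0E x I.
  by move/fine_cvgP => [_].
Qed.

Lemma bfunctional_eq_indic l l' : bfunctional l -> bfunctional l' ->
  (forall A, measurable A -> l \1_A = l' \1_A) ->
  forall f, bmfun f -> l f = l' f.
Proof.
move=> bl bl' ll' f bf.
have := bclosed_bmfun (bclosed_eq_bfunctional bl bl') _ bf; case=> //.
by move=> A mA; split; [exact: bmfun_indic|exact: ll'].
Qed.

Lemma bfunctional_eq_dynkin l l' (G : set (set T)) :
  @measurable _ T = <<s G >> -> setI_closed G ->
  bfunctional l -> bfunctional l' -> l (fun=> 1) = l' (fun=> 1) ->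
  (forall A, G A -> l \1_A = l' \1_A) ->
  forall f, bmfun f -> l f = l' f.
Proof.
move=> GE GI bl bl' ll1 llG; apply: bfunctional_eq_indic => // A mA.
have bL := bclosed_eq_bfunctional bl bl'.
have := bclosed_dynkin GE GI bL _ _ mA; case=> //.
  by split; [exact: bmfun_cst|].
move=> B GB; split; last exact: llG.
by apply: bmfun_indic; rewrite GE; exact: sub_gen_smallest.
Qed.

End bounded_measurable.

Lemma bmfun_comp (R : realType) d (T : measurableType d) d' (U : measurableType d')
    (p : T -> U) (f : U -> R) :
  measurable_fun setT p -> bmfun f -> bmfun (fun x => f (p x)).
Proof.
move=> mp [mf [M fM]]; split; last by exists M.
exact: measurableT_comp.
Qed.

Lemma bfunctional_int (R : realType) d (T : measurableType d)
    d' (U : measurableType d') (m : probability T R) (p : T -> U) (h : T -> R) :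
  measurable_fun setT p -> bmfun h ->
  bfunctional (fun f : U -> R => \int[m]_x (f (p x) * h x)).
Proof.
move=> mp bh; split.
  move=> a f g bf bg; rewrite -RintegralZD.
  - by apply: eq_Rintegral => x _; ring.
  - by apply: bmfunM => //; exact: bmfun_comp.
  - by apply: bmfunM => //; exact: bmfun_comp.
move=> F f M bF FM Ff; case: (bh) => mh [N hN].
apply: (@bounded_convergence _ _ _ m _ _ (M * N)).
- by move=> n; apply: bmfunM => //; exact: bmfun_comp.
- by move=> n x; rewrite normrM ler_pM.
- by move=> x; apply: cvgMl; exact: Ff.
Qed.

Lemma bfunctional_int_comp (R : realType) d (T : measurableType d)
    d' (U : measurableType d') (m : probability T R) (p : T -> U) :
  measurable_fun setT p -> bfunctional (fun f : U -> R => \int[m]_x f (p x)).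
Proof.
move=> mp; have := bfunctional_int m mp (bmfun_cst _ 1).
by under eq_fun do under eq_Rintegral do rewrite mulr1.
Qed.

Lemma fine_probability_inj (R : realType) d (T : measurableType d)
    d' (U : measurableType d') (m : probability T R) (m' : probability U R) A B :
  measurable A -> measurable B -> fine (m A) = fine (m' B) -> m A = m' B.
Proof.
move=> mA mB h.
by rewrite -(fineK (fin_num_measure m A mA)) h fineK// fin_num_measure.
Qed.

Lemma Rintegral_preserving (R : realType) d (T : measurableType d)
    d' (U : measurableType d') (m : probability T R) (m' : probability U R) p
    (f : U -> R) :
  measure_preserving m m' p -> bmfun f -> \int[m]_x f (p x) = \int[m']_x f x.
Proof.
move=> [mp pm] bf.
have bl := bfunctional_int_comp m mp.
have bl' := @bfunctional_int_comp R _ _ _ U m' id (@measurable_id _ _ _).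
apply: (bfunctional_eq_indic bl bl' _ bf) => A mA.
rewrite (Rintegral_indic _ mA) -pm//.
rewrite -(@Rintegral_indic _ _ _ m (p @^-1` A))//.
by rewrite -[X in measurable X]setTI; exact: mp.
Qed.

Lemma measure_preservingP (R : realType) d (T : measurableType d)
    d' (U : measurableType d') (m : probability T R) (m' : probability U R) p :
  measurable_fun setT p ->
  (forall A, measurable A -> \int[m]_x \1_A (p x) = \int[m']_x \1_A x :> R) ->
  measure_preserving m m' p.
Proof.
move=> mp h; split => // A mA.
have mpA : measurable (p @^-1` A) by rewrite -[X in measurable X]setTI; exact: mp.
apply: fine_probability_inj => //.
by rewrite -!Rintegral_indic// -h.
Qed.

Lemma bfunctionalZ (R : realType) d (T : measurableType d) (l : (T -> R) -> R) a :
  bfunctional l -> bfunctional (fun f => a * l f).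
Proof.
move=> [l1 l2]; split; first by move=> b f g bf bg; rewrite l1//; ring.
by move=> F f M bF FM Ff; apply: cvgMr; exact: l2 bF FM Ff.
Qed.

(** * Polynomial approximation of a step function *)

Section step_polynomial.
Variable R : realType.

Lemma cvg_natr_mul_expr (x : R) : 0 <= x < 1 -> n%:R * x ^+ n @[n --> \oo] --> 0.
Proof.
move=> /andP[x0 x1].
have [->|xn0] := eqVneq x 0.
  apply: cvg_near_cst; exists 1%N => // -[//|n] _.
  by rewrite expr0n mulr0.
(* Write x^n = y^n y^n: Bernoulli's inequality for 1/y bounds n y^n by K, and the remaining factor
   y^n tends to 0. *)
pose y := Num.sqrt x.
have yx : y ^+ 2 = x by rewrite sqr_sqrtr.
have y0 : 0 < y by rewrite sqrtr_gt0 lt_neqAle eq_sym xn0.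
have y1 : y < 1 by rewrite -sqrtr1 ltr_sqrt.
pose K := (y^-1 - 1)^-1.
have K0 : 0 < y^-1 - 1 by rewrite subr_gt0 invf_gt1.
have bern n : n%:R * (y^-1 - 1) <= y^-1 ^+ n.
  elim: n => [|n ih]; first by rewrite mul0r expr0.
  have h : 1 <= y^-1 ^+ n by rewrite exprn_ege1// ltW// invf_gt1.
  rewrite exprS -natr1; nra.
have ny n : n%:R * y ^+ n <= K.
  rewrite /K -[leRHS]mul1r ler_pdivlMr//.
  have yn : 0 < y ^+ n by rewrite exprn_gt0.
  rewrite mulrAC -(@ler_pdivlMr _ (y ^+ n))// mul1r -exprVn; exact: bern.
apply: (@squeeze_cvgr _ _ _ _ (fun=> 0) (fun n => K * y ^+ n)).
- apply: nearW => n; rewrite mulr_ge0 ?exprn_ge0//=.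
  rewrite -yx -exprM mulnC exprM expr2 mulrA ler_wpM2r ?exprn_ge0//; exact: ltW.
- exact: cvg_cst.
- rewrite -(mulr0 K); apply: cvgMr; apply: cvg_expr.
  by rewrite ger0_norm// ltW.
Qed.

(* Bernoulli's inequality makes (1 - s^n)^(n 2^n) converge to 1 for s < 1/2, and
   to 0 for s >= 1/2; the extra factor n in the exponent settles s = 1/2. *)
Definition half_step (n : nat) (s : R) : R := (1 - s ^+ n) ^+ (n * 2 ^ n).

Lemma half_step_itv n s : 0 <= s <= 1 -> 0 <= half_step n s <= 1.
Proof.
move=> /andP[s0 s1].
have sn0 : 0 <= s ^+ n by rewrite exprn_ge0.
have sn1 : s ^+ n <= 1 by rewrite exprn_ile1.
by rewrite /half_step exprn_ge0 ?exprn_ile1//; lra.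
Qed.

Lemma bernoulli_ineq (x : R) k : -1 <= x -> 1 + k%:R * x <= (1 + x) ^+ k.
Proof.
move=> x1; elim: k => [|k ih]; first by rewrite mul0r addr0 expr0.
rewrite exprS -natr1.
have kx : 0 <= k%:R * x ^+ 2 by rewrite mulr_ge0// sqr_ge0.
have : (1 + x) * (1 + k%:R * x) <= (1 + x) * (1 + x) ^+ k by rewrite ler_wpM2l//; lra.
by apply: le_trans; rewrite expr2 in kx; lra.
Qed.

(** For s < 1/2 Bernoulli's inequality gives the lower bound 1 - n (2s)^n. For s >= 1/2 the value is
    at most the inverse of (1 + s^n)^N, with N the exponent of [half_step], and this power is at
    least N s^n = n (2s)^n >= n. *)
Lemma cvg_half_step s : 0 <= s <= 1 ->
  half_step n s @[n --> \oo] --> ((s < 1 / 2)%R%:R : R).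
Proof.
move=> s01; case/andP: (s01) => s0 s1.
have [s2|s2] := ltP s (1 / 2) => /=.
  apply: (@squeeze_cvgr _ _ _ _ (fun n => 1 - n%:R * (2 * s) ^+ n) (fun=> 1)).
  - apply: nearW => n; have /andP[_ ->] := half_step_itv n s01.
    rewrite andbT /half_step.
    have sn1 : s ^+ n <= 1 by rewrite exprn_ile1.
    have := @bernoulli_ineq (- s ^+ n) (n * 2 ^ n); rewrite lerN2 => /(_ sn1).
    apply: le_trans; rewrite natrM natrX exprMn; lra.
  - rewrite -[X in _ --> X]subr0; apply: cvgB; first exact: cvg_cst.
    by apply: cvg_natr_mul_expr; lra.
  - exact: cvg_cst.
(* The bound obtained is 1/n; [harmonic n] is 1/(n + 1), and the factor 2 makes up for the shift
   when n >= 1. *)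
apply: (@squeeze_cvgr _ _ _ _ (fun=> 0) (fun n => 2 * harmonic n)).
- exists 1%N => // n /= n0; have /andP[-> _] := half_step_itv n s01.
  rewrite /=.
  have n0' : (0 < n%:R :> R) by rewrite ltr0n.
  have sn0 : 0 <= s ^+ n by rewrite exprn_ge0.
  have sn1 : s ^+ n <= 1 by rewrite exprn_ile1.
  set N := (n * 2 ^ n)%N.
  have h1 : half_step n s * (1 + s ^+ n) ^+ N <= 1.
    rewrite /half_step -exprMn exprn_ile1//; nra.
  have h2 : n%:R <= (1 + s ^+ n) ^+ N.
    apply: le_trans (bernoulli_ineq N _); last lra.
    rewrite natrM natrX -mulrA -exprMn.
    have : 1 <= (2 * s) ^+ n by rewrite exprn_ege1//; lra.
    nra.
  have /andP[h0 _] := half_step_itv n s01.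
  apply: (@le_trans _ _ (n%:R^-1)).
    rewrite -[leRHS]mul1r ler_pdivlMr//; apply: le_trans h1.
    by rewrite ler_wpM2l.
  rewrite /harmonic/= ler_pdivlMr ?ltr0n// mulrC ler_pdivrMr// -natr1.
  have : 1 <= n%:R :> R by rewrite ler1n.
  lra.
- exact: cvg_cst.
- by rewrite -[X in _ --> X](mulr0 (2 : R)); apply: cvgMr; exact: cvg_harmonic.
Qed.

End step_polynomial.

(** * The multiplicative monotone class theorem *)

Section algebra_class.
Context (R : realType) (T : Type) (J : eqType) (c : J -> T -> R) (M : R).
Hypothesis cM : forall j x, `|c j x| <= M.

Definition lt_cell (l : seq (J * R)) : set T :=
  [set x | forall k, k \in l -> c k.1 x < k.2].

Lemma lt_cellI : setI_closed [set A | exists l, A = lt_cell l].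
Proof.
move=> A B [l ->] [l' ->]; exists (l ++ l'); apply/seteqP; split => x /=.
  by move=> [h h'] k; rewrite mem_cat => /orP[/h|/h'].
by move=> h; split => k kl; apply: h; rewrite mem_cat kl ?orbT.
Qed.

End algebra_class.

(** Induction on the constraints: the indicator of c_j < r is a bounded limit of polynomials in c_j.
    The product over an arbitrary [s] is carried along because multiplication by c_j then only
    lengthens [s], which keeps the polynomials inside the class. *)
Lemma bclosed_algebra (R : realType) (T : Type) (J : eqType)
    (c : J -> T -> R) (M : R) (L : set (T -> R)) :
  (forall j x, `|c j x| <= M) ->
  bclosed L ->
  (forall s : seq J, L (fun x => \prod_(j <- s) c j x)) ->
  forall (l : seq (J * R)) (s : seq J),
    L (fun x => \1_(lt_cell c l) x * \prod_(j <- s) c j x).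
Proof.
move=> cM bL Lc; elim=> [|[j r] l ih] s.
  have -> : lt_cell c [::] = setT by apply/seteqP; split.
  by under eq_fun do rewrite indicT mul1r.
have L0 : L (fun=> 0).
  have := bL.1 (-1) _ _ (Lc [::]) (Lc [::]).
  by under eq_fun do rewrite mulN1r addNr.
have Lpoly (p : {poly R}) s' :
    L (fun x => p.[c j x] * (\1_(lt_cell c l) x * \prod_(j <- s') c j x)).
  elim/poly_ind: p s' => [|p a ihp] s'.
    by under eq_fun do rewrite horner0 mul0r.
  have := bL.1 a _ _ (ih s') (ihp (j :: s')); congr L; apply/funext => x.
  rewrite big_cons hornerD hornerM hornerX hornerC.
  by set u : R := \1_(_) x; set v : R := \prod_(_ <- s') _; ring.
(* A bound M can be negative only on an empty T, where all functions coincide with 0. *)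
have M0 : 0 <= M \/ forall x : T, False.
  have [[x _]|h] := pselect (exists x : T, True); last by right=> x; apply: h; exists x.
  by left; rewrite (le_trans _ (cM j x)).
case: M0 => [M0|Te]; last first.
  by move: L0; congr L; apply/funext => x; case: (Te x).
(* B exceeds |t - r| for |t| <= M, so the affine map [a] sends [-M, M] into [0, 1] and r to 1/2, the
   jump of the limit of [half_step]. The summand 1 keeps B positive. *)
pose B := M + `|r| + 1.
have B0 : 0 < B by rewrite /B; have := normr_ge0 r; lra.
pose a (t : R) := 1 / 2 + (t - r) / (2 * B).
have aE t : `|t| <= M -> 0 <= a t <= 1.
  move=> tM; have : `|(t - r) / (2 * B)| <= 1 / 2.
    rewrite normrM normfV (gtr0_norm (_ : 0 < 2 * B)); last lra.
    rewrite ler_pdivrMr; last lra.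
    by rewrite (le_trans (ler_normB _ _))// /B; lra.
  by rewrite ler_norml /a => /andP[]; lra.
have a2 t : (a t < 1 / 2) = (t < r).
  rewrite /a gtrDl pmulr_llt0 ?subr_lt0// invr_gt0; lra.
pose pa : {poly R} := (2 * B)^-1 *: 'X + (1 / 2 - r / (2 * B))%:P.
have paE t : pa.[t] = a t by rewrite /pa /a hornerD hornerZ hornerX hornerC; set z := _^-1; ring.
pose P n : {poly R} := (1 - pa ^+ n) ^+ (n * 2 ^ n).
have PE n t : (P n).[t] = half_step n (a t).
  by rewrite /P /half_step horner_exp hornerD hornerN hornerC horner_exp paE.
apply: (bL.2 (fun n x => (P n).[c j x] * (\1_(lt_cell c l) x * \prod_(j <- s) c j x))
  _ (1 * (1 * M ^+ size s))).
- by move=> n; exact: Lpoly.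
- move=> n x; rewrite PE !normrM; have := half_step_itv n (aE _ (cM j x)).
  move=> /andP[h0 h1]; rewrite ler_pM//; first by rewrite ger0_norm.
  rewrite ler_pM//; first by rewrite indicE; case: (_ \in _); rewrite ?normr1 ?normr0.
  elim: s => [|i s ihs]; first by rewrite big_nil normr1.
  by rewrite big_cons normrM exprS ler_pM.
- move=> x; have -> : \1_(lt_cell c ((j, r) :: l)) x =
      (a (c j x) < 1 / 2)%R%:R * \1_(lt_cell c l) x :> R.
    rewrite a2 !indicE -natrM mulnb; congr (_%:R); congr nat_of_bool.
    apply/idP/idP => [|/andP[cr]]; rewrite inE.
      move=> h; rewrite (h (j, r)) ?mem_head//= mem_set// => k kl.
      by apply: h; rewrite inE kl orbT.
    move=> h; apply: mem_set => k; rewrite inE => /orP[/eqP ->//|].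
    exact: h.
  rewrite -mulrA; apply: cvgMl; under eq_fun do rewrite PE.
  by apply: cvg_half_step; exact: aE.
Qed.

Lemma bclosed_lt_cell (R : realType) (T : pointedType) (J : eqType)
    (c : J -> T -> R) (M : R) (L : set (T -> R)) :
  (forall j x, `|c j x| <= M) ->
  bclosed L ->
  (forall s : seq J, L (fun x => \prod_(j <- s) c j x)) ->
  forall A, <<s [set A | exists l, A = lt_cell c l] >> A -> L \1_A.
Proof.
move=> cM bL Lc A mA; set G := [set A | _] in mA.
apply: (@bclosed_dynkin _ _ (g_sigma_algebraType G) L G erefl (@lt_cellI _ _ _ c)
  bL) => //.
  by have := Lc [::]; under eq_fun do rewrite big_nil.
move=> _ [l ->]; have := bclosed_algebra cM bL Lc l [::].
by under eq_fun do rewrite big_nil mulr1.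
Qed.

(** * Characters of the torus *)

Section circle_theory.
Variable R : realType.
Local Notation circle := (circle R).
Local Notation circle_pi := (@circle_pi R).

Lemma circle_piD x y : circle_pi (x + y) = circle_pi x + circle_pi y.
Proof. exact: (raddfD (\pi_(Quotient.quot (integers R))%qT)). Qed.

Lemma circle_piN x : circle_pi (- x) = - circle_pi x.
Proof. exact: (raddfN (\pi_(Quotient.quot (integers R))%qT)). Qed.

Lemma circle_piMz x n : circle_pi (x *~ n) = circle_pi x *~ n.
Proof. exact: (raddfMz (\pi_(Quotient.quot (integers R))%qT)). Qed.

Lemma circle_pi_eq x y : x - y \is a Num.int -> circle_pi x = circle_pi y.
Proof.
move=> xy; apply/eqP.
by have := Quotient.idealrBE (integers R) x y; rewrite /circle_pi => <-.
Qed.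

Lemma circle_piP (c : circle) : exists x, c = circle_pi x.
Proof. by exists (repr c); rewrite /circle_pi reprK. Qed.

Definition fracpart (x : R) : R := x - (Num.floor x)%:~R.

Lemma fracpart_itv x : 0 <= fracpart x < 1.
Proof.
by have /andP[] := floor_itv x; rewrite /fracpart intrD; lra.
Qed.

Lemma circle_pi_frac x : circle_pi (fracpart x) = circle_pi x.
Proof. by apply: circle_pi_eq; rewrite /fracpart addrAC subrr add0r rpredN intr_int. Qed.

Lemma measurable_fracpart : measurable_fun setT fracpart.
Proof.
apply: measurable_funB => //.
apply: nondecreasing_measurable => //= x y xy; rewrite ler_int.
exact: le_floor.
Qed.

(** [repr] picks an arbitrary real representative; the fractional part normalizes it to the one in
    [0, 1[, which depends measurably on the class. *)
Definition circle_rep (c : circle) : R := fracpart (repr c).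

Lemma circle_repK c : circle_pi (circle_rep c) = c.
Proof. by rewrite /circle_rep circle_pi_frac /circle_pi reprK. Qed.

Lemma circle_pi_rep x : circle_rep (circle_pi x) = fracpart x.
Proof.
have : circle_pi (repr (circle_pi x)) = circle_pi x by rewrite /circle_pi reprK.
move=> /eqP; have := Quotient.idealrBE (integers R) (repr (circle_pi x)) x.
rewrite /circle_pi => <-; rewrite -/circle_pi => h.
have {h} : repr (circle_pi x) - x \is a Num.int by [].
rewrite /circle_rep => /intrP[n hn].
have -> : repr (circle_pi x) = x + n%:~R by rewrite -hn addrC subrK.
rewrite /fracpart floorDrz ?intr_int// intrKfloor intrD; ring.
Qed.

Lemma measurable_circle_pi : measurable_fun setT circle_pi.
Proof. by move=> _ A mA; rewrite setTI. Qed.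

Lemma measurable_circle_rep : measurable_fun setT circle_rep.
Proof.
move=> _ A mA; rewrite setTI /measurable/= /circle_measurable/=.
have -> : circle_pi @^-1` (circle_rep @^-1` A) = fracpart @^-1` A.
  by apply/seteqP; split => x /=; rewrite circle_pi_rep.
by rewrite -[X in measurable X]setTI; exact: measurable_fracpart.
Qed.

Lemma measurable_circleP d (M : measurableType d) (c : M -> circle) :
  measurable_fun setT (circle_rep \o c) -> measurable_fun setT c.
Proof.
move=> mc; have -> : c = circle_pi \o (circle_rep \o c).
  by apply/funext => x /=; rewrite circle_repK.
by apply: measurableT_comp mc; exact: measurable_circle_pi.
Qed.

Lemma measurable_circleD d (M : measurableType d) (a b : M -> circle) :
  measurable_fun setT a -> measurable_fun setT b ->
  measurable_fun setT (fun x => a x + b x).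
Proof.
move=> ma mb.
have -> : (fun x => a x + b x) =
    circle_pi \o (fun x => circle_rep (a x) + circle_rep (b x)).
  by apply/funext => x /=; rewrite circle_piD !circle_repK.
apply: measurableT_comp; first exact: measurable_circle_pi.
by apply: measurable_funD; (apply: measurableT_comp => //; exact: measurable_circle_rep).
Qed.

Lemma measurable_circleMz d (M : measurableType d) (a : M -> circle) n :
  measurable_fun setT a -> measurable_fun setT (fun x => a x *~ n).
Proof.
move=> ma.
have -> : (fun x => a x *~ n) = circle_pi \o (fun x => n%:~R * circle_rep (a x)).
  by apply/funext => x /=; rewrite mulrzl circle_piMz circle_repK.
apply: measurableT_comp; first exact: measurable_circle_pi.
by apply: measurable_funM => //; apply: measurableT_comp => //; exact: measurable_circle_rep.
Qed.

(* cas x and cas (- x) span cos x and sin x, so that one real family indexed by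
   Z^2 replaces the complex characters. *)
Definition cas (x : R) : R := cos x + sin x.

(** The product is cos(x - y) + sin(x + y), and each term is a combination of two values of [cas].
    Hence the linear span of the real characters is an algebra. *)
Lemma cas_mul x y : cas x * cas y =
  2^-1 * (cas (x - y) + cas (- (x - y)) + cas (x + y) - cas (- (x + y))).
Proof. by rewrite /cas !cosN !sinN !cosD !sinD !cosN !sinN; field. Qed.

Lemma cos_cas x : cos x = 2^-1 * (cas x + cas (- x)).
Proof. by rewrite /cas cosN sinN; field. Qed.

Lemma sin_cas x : sin x = 2^-1 * (cas x - cas (- x)).
Proof. by rewrite /cas cosN sinN; field. Qed.

Lemma cas_norm x : `|cas x| <= 2.
Proof.
rewrite /cas (le_trans (ler_normD _ _))//.
by have := cos_max x; have := sin_max x; lra.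
Qed.

Lemma cos_sin_2piz (n : int) :
  cos (pi *+ 2 * n%:~R) = 1 :> R /\ sin (pi *+ 2 * n%:~R) = 0 :> R.
Proof.
have H (k : nat) : cos (pi *+ 2 * k%:R) = 1 :> R /\ sin (pi *+ 2 * k%:R) = 0 :> R.
  rewrite mulr_natr -[X in cos X]add0r -[X in sin X]add0r.
  by rewrite (periodicn (@cosD2pi R)) (periodicn (@sinD2pi R)) cos0 sin0.
case: n => k; first exact: H.
by rewrite NegzE mulrNz mulrN cosN sinN; have [-> ->] := H k.+1; rewrite oppr0.
Qed.

Lemma cas_periodic x (n : int) : cas (pi *+ 2 * (x + n%:~R)) = cas (pi *+ 2 * x).
Proof.
rewrite /cas mulrDr cosD sinD; have [-> ->] := cos_sin_2piz n.
by rewrite !mulr1 !mulr0 subr0 addr0.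
Qed.

Definition ccas (c : circle) : R := cas (pi *+ 2 * circle_rep c).

Lemma ccas_pi x : ccas (circle_pi x) = cas (pi *+ 2 * x).
Proof.
rewrite /ccas circle_pi_rep -[in RHS](subrK (Num.floor x)%:~R x).
by rewrite cas_periodic.
Qed.

Lemma ccas_mul a b : ccas a * ccas b =
  2^-1 * (ccas (a - b) + ccas (- (a - b)) + ccas (a + b) - ccas (- (a + b))).
Proof.
have [x ->] := circle_piP a; have [y ->] := circle_piP b.
rewrite -!circle_piN -!circle_piD -!circle_piN !ccas_pi cas_mul.
by rewrite !mulrN !mulrDr !mulrN.
Qed.

Lemma ccas_norm c : `|ccas c| <= 2.
Proof. exact: cas_norm. Qed.

Lemma measurable_cas : measurable_fun setT cas.
Proof.
apply: continuous_measurable_fun => x; apply: cvgD.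
  exact: continuous_cos.
exact: continuous_sin.
Qed.

Lemma measurable_ccas : measurable_fun setT ccas.
Proof.
apply: (measurableT_comp measurable_cas); apply: measurable_funM => //.
exact: measurable_circle_rep.
Qed.

(** Clamping makes the arc cosine nonincreasing on the whole line, from which its measurability
    follows; values at cosines are unchanged. *)
Definition clamp_acos (t : R) : R := acos (Num.max (-1) (Num.min 1 t)).

Lemma measurable_clamp_acos : measurable_fun setT clamp_acos.
Proof.
apply: nonincreasing_measurable => // x y xy.
have cl (t : R) : -1 <= Num.max (-1) (Num.min 1 t) <= 1.
  by rewrite le_max lexx/= ge_max ge_min lexx/= andbT; lra.
have cxy : Num.max (-1) (Num.min 1 x) <= Num.max (-1) (Num.min 1 y).
  rewrite ge_max le_max lexx/= le_max; apply/orP; right.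
  by rewrite le_min !ge_min lexx xy/= orbT.
rewrite /clamp_acos; have := cl x; have := cl y; move: cxy.
set a := Num.max _ (Num.min _ x); set b := Num.max _ (Num.min _ y) => cxy cb ca.
rewrite leNgt; apply/negP => ba.
have : cos (acos b) < cos (acos a).
  rewrite ltr_cos// in_itv/=.
    by rewrite acos_ge0 ?acos_lepi.
  by rewrite acos_ge0 ?acos_lepi.
by rewrite !acosK ?in_itv/=// ltNge cxy.
Qed.

(** C and S are the cosine and the sine of the angle. The cosine determines the angle up to sign and
    the sign of the sine decides, so a point is a measurable function of its two real characters. *)
Lemma circle_repE c (C := 2^-1 * (ccas c + ccas (- c)))
    (S := 2^-1 * (ccas c - ccas (- c))) :
  circle_rep c = if 0 <= S then clamp_acos C / (pi *+ 2)
                 else 1 - clamp_acos C / (pi *+ 2).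
Proof.
have p0 : 0 < pi *+ 2 :> R by rewrite pmulrn_lgt0// pi_gt0.
have pp := @pi_gt0 R.
set t := circle_rep c; have /andP[t0 t1] : 0 <= t < 1 by exact: fracpart_itv.
have cE : ccas c = cas (pi *+ 2 * t) by [].
have cNE : ccas (- c) = cas (- (pi *+ 2 * t)).
  by rewrite -[c]circle_repK -circle_piN ccas_pi mulrN.
have -> : C = cos (pi *+ 2 * t) by rewrite /C cE cNE -cos_cas.
have -> : S = sin (pi *+ 2 * t) by rewrite /S cE cNE -sin_cas.
have cl x : clamp_acos (cos x) = acos (cos x).
  by rewrite /clamp_acos min_r ?cos_le1// max_r// cos_geN1.
rewrite cl; have [t2|t2] := leP t (1 / 2).
  have h : 0 <= pi *+ 2 * t <= pi.
    rewrite mulr_ge0 ?(ltW p0)//= mulr2n mulrDl; nra.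
  rewrite sin_ge0_pi// cosK ?in_itv//= mulrC mulKf//; exact: lt0r_neq0.
(* Reflection of the lower half circle: 0 < s < 1/2, so the sine is strictly negative and the second
   branch is taken. *)
pose s := 1 - t.
have tE : pi *+ 2 * t = - (pi *+ 2 * s) + pi *+ 2 by rewrite /s; ring.
rewrite tE cosD2pi sinD2pi cosN sinN.
have h : 0 < pi *+ 2 * s < pi.
  have s0 : 0 < s by rewrite /s subr_gt0.
  have s1 : s < 1 / 2 by rewrite /s; lra.
  by rewrite mulr_gt0//= mulr2n mulrDl; nra.
rewrite oppr_ge0 leNgt sin_gt0_pi//= cosK ?in_itv/=.
  rewrite mulrC mulKf; [by rewrite /s; ring|exact: lt0r_neq0].
by case/andP: h => h1 h2; rewrite !ltW.
Qed.

Lemma measurable_circle_ccas d (M : measurableType d) (c : M -> circle) :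
  measurable_fun setT (fun x => ccas (c x)) ->
  measurable_fun setT (fun x => ccas (- c x)) -> measurable_fun setT c.
Proof.
move=> m1 m2; apply: measurable_circleP.
have -> : circle_rep \o c = fun x =>
    if 0 <= 2^-1 * (ccas (c x) - ccas (- c x))
    then clamp_acos (2^-1 * (ccas (c x) + ccas (- c x))) / (pi *+ 2)
    else 1 - clamp_acos (2^-1 * (ccas (c x) + ccas (- c x))) / (pi *+ 2).
  by apply/funext => x; exact: circle_repE.
have mC : measurable_fun setT
    (fun x => clamp_acos (2^-1 * (ccas (c x) + ccas (- c x))) / (pi *+ 2)).
  apply: measurable_funM => //; apply: measurableT_comp.
    exact: measurable_clamp_acos.
  by apply: measurable_funM => //; exact: measurable_funD.
apply: measurable_fun_ifT => //.
  apply: measurable_fun_ler => //.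
  by apply: measurable_funM => //; exact: measurable_funB.
exact: measurable_funB.
Qed.

End circle_theory.

(** Both sides are bounded functionals of f for fixed g, and of g for fixed f, so only rectangles
    have to be compared. *)
Lemma Rintegral_prod (R : realType) d1 d2 (T1 : measurableType d1)
    (T2 : measurableType d2) (m1 : probability T1 R) (m2 : probability T2 R)
    (f : T1 -> R) (g : T2 -> R) : bmfun f -> bmfun g ->
  \int[(m1 \x m2)%E]_w (f w.1 * g w.2) = \int[m1]_x f x * \int[m2]_y g y.
Proof.
move=> bf bg.
have mfst : measurable_fun setT (@fst T1 T2) := measurable_fst.
have msnd : measurable_fun setT (@snd T1 T2) := measurable_snd.
have bl2 : bfunctional (fun f => \int[m1]_x f x * \int[m2]_y g y).
  have -> : (fun f => \int[m1]_x f x * \int[m2]_y g y) =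
      (fun f : T1 -> R => \int[m2]_y g y * \int[m1]_x f (id x)).
    by apply/funext => h; rewrite mulrC.
  apply: bfunctionalZ; exact: (@bfunctional_int_comp _ _ _ _ _ m1 id).
apply: (bfunctional_eq_indic (bfunctional_int _ mfst (bmfun_comp msnd bg)) bl2 _ bf).
move=> A mA.
have h : bfunctional (fun g : T2 -> R => \int[(m1 \x m2)%E]_x (\1_A x.1 * g x.2)).
  have := bfunctional_int (m1 \x m2)%E msnd (bmfun_comp mfst (bmfun_indic R mA)).
  by under eq_fun do under eq_Rintegral do rewrite mulrC.
have h' : bfunctional (fun g => \int[m1]_x \1_A x * \int[m2]_y g y).
  by apply: bfunctionalZ; exact: (@bfunctional_int_comp _ _ _ _ _ m2 id).
apply: (bfunctional_eq_indic h h' _ bg) => B mB.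
transitivity (\int[(m1 \x m2)%E]_x \1_(A `*` B) x).
  apply: eq_Rintegral => x _.
  by rewrite !indicE -natrM mulnb -in_setX; case: x.
rewrite !Rintegral_indic//; last exact: measurableX.
transitivity (fine (m1 A * m2 B)%E); first by congr fine; exact: product_measure1E.
by rewrite fineM//; exact: fin_num_measure.
Qed.

Section torus_theory.
Variable R : realType.
Local Notation torus2 := (torus2 R).
Implicit Types v : int * int.

Definition tchar v (x : torus2) : R := ccas (x.1 *~ v.1 + x.2 *~ v.2).

Lemma tchar0 x : tchar (0, 0) x = 1.
Proof.
rewrite /tchar !mulr0z addr0.
have -> : (0 : circle R) = circle_pi 0 by apply/esym/(raddf0 (\pi_(Quotient.quot (integers R))%qT)).
by rewrite ccas_pi mulr0 /cas cos0 sin0 addr0.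
Qed.

Lemma tchar_norm v x : `|tchar v x| <= 2.
Proof. exact: ccas_norm. Qed.

Lemma bmfun_tchar v : bmfun (tchar v).
Proof.
split; last by exists 2; exact: tchar_norm.
apply: measurableT_comp; first exact: measurable_ccas.
apply: measurable_circleD; apply: measurable_circleMz.
  exact: measurable_fst.
exact: measurable_snd.
Qed.

Lemma tchar_mul v w x : tchar v x * tchar w x =
  2^-1 * (tchar (v - w) x + tchar (- (v - w)) x + tchar (v + w) x
          - tchar (- (v + w)) x).
Proof.
rewrite /tchar ccas_mul; case: v => v1 v2; case: w => w1 w2 /=.
by congr (_ * (ccas _ + ccas _ + ccas _ - ccas _));
  rewrite !(mulrzDr, mulrNz, opprD, opprK, mulrzBr) addrACA.
Qed.

Lemma tchar_bclosed_prod (L : set (torus2 -> R)) : bclosed L ->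
  (forall v, L (tchar v)) -> forall s : seq (int * int),
  L (fun x => \prod_(v <- s) tchar v x).
Proof.
move=> [L1 _] Lt s.
suff H v : L (fun x => tchar v x * \prod_(v <- s) tchar v x).
  by have := H (0, 0); under eq_fun do rewrite tchar0 mul1r.
elim: s v => [|w s ih] v.
  by under eq_fun do rewrite big_nil mulr1.
(* The closure property adds its last function with coefficient 1, so the coefficient 1/2 of v - w
   is written as (1/2 - 1) + 1. *)
have := L1 (- 2^-1) _ _ (ih (- (v + w))) (L1 2^-1 _ _ (ih (v + w))
  (L1 2^-1 _ _ (ih (- (v - w))) (L1 (2^-1 - 1) _ _ (ih (v - w)) (ih (v - w))))).
congr L; apply/funext => x; rewrite big_cons [in RHS]mulrA [in RHS]tchar_mul.
by set a := tchar _ x; set b := tchar _ x; set p := \prod_(_ <- _) _; field.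
Qed.

(** Totality of the characters. Their span is an algebra, and the four characters at (1, 0), (-1,
    0), (0, 1) and (0, -1) already determine both coordinates measurably, so their level sets
    generate the sigma-algebra of the torus. *)
Lemma bclosed_tchar (L : set (torus2 -> R)) : bclosed L ->
  (forall v, L (tchar v)) -> forall f, bmfun f -> L f.
Proof.
move=> bL Lt; apply: bclosed_bmfun => // A mA.
apply: (bclosed_lt_cell tchar_norm bL (tchar_bclosed_prod bL Lt)).
set G := [set A | _].
pose M := g_sigma_algebraType G.
have mt v : measurable_fun [set: M] (tchar v).
  apply: (measurability _ (RGenInftyO.measurableE R)) => //.
  move=> _ [_ [r ->] <-]; rewrite setTI; apply: sub_gen_smallest.
  exists [:: (v, r)]; apply/seteqP; split => x /=; rewrite in_itv/=.
    by move=> h k; rewrite inE => /eqP ->.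
  by move=> /(_ (v, r)); apply; rewrite mem_head.
have mid : measurable_fun [set: M] (id : M -> torus2).
  apply/measurable_fun_pairP; split; apply: measurable_circle_ccas.
  - have := mt (1, 0); congr (measurable_fun _ _).
    by apply/funext => x; rewrite /tchar/= mulr1z mulr0z addr0.
  - have := mt (-1, 0); congr (measurable_fun _ _).
    by apply/funext => x; rewrite /tchar/= mulrN1z mulr0z addr0.
  - have := mt (0, 1); congr (measurable_fun _ _).
    by apply/funext => x; rewrite /tchar/= mulr1z mulr0z add0r.
  - have := mt (0, -1); congr (measurable_fun _ _).
    by apply/funext => x; rewrite /tchar/= mulrN1z mulr0z add0r.
by have := mid measurableT A mA; rewrite setTI.
Qed.

(** The transposed matrix applied to v, that is, the dual action on characters. It composes in the
    reverse order. *)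
Definition int2_action (g : SL2Z) (v : int * int) : int * int :=
  (g 0 0 * v.1 + g 1 0 * v.2, g 0 1 * v.1 + g 1 1 * v.2).

Lemma tchar_action g v x : tchar v (torus2_action g x) = tchar (int2_action g v) x.
Proof.
rewrite /tchar /torus2_action /int2_action/=; congr ccas.
by rewrite !mulrzDl !mulrzDr !mulrzA addrACA.
Qed.

Lemma int2_actionM g h v :
  int2_action (g * h)%g v = int2_action h (int2_action g v).
Proof.
rewrite -[(g * h)%g]/(SL2Z_mul g h) /int2_action /= !mxE !big_ord_recl !big_ord0 !addr0/=.
have e1 : lift ord0 ord0 = 1 :> 'I_2 by apply: val_inj.
have e0 : ord0 = 0 :> 'I_2 by apply: val_inj.
by rewrite !e1 e0; congr pair; ring.
Qed.

Lemma int2_action1 v : int2_action 1%g v = v.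
Proof.
by case: v => a b; rewrite /int2_action /= !mxE/= !mul1r !mul0r addr0 add0r.
Qed.

Lemma int2_action0 g : int2_action g (0, 0) = (0, 0).
Proof. by rewrite /int2_action/= !mulr0 addr0. Qed.

Lemma int2_action_eq0 g v : (int2_action g v == (0, 0)) = (v == (0, 0)).
Proof.
apply/eqP/eqP => [h|->]; last exact: int2_action0.
by rewrite -(int2_action1 v) -(mulgV g) int2_actionM h int2_action0.
Qed.

(** The two laws differ only by the endpoint 1, a null set. The closed interval is the one on which
    the fundamental theorem of calculus is applied. *)
Lemma haar_circle_uniform (A : set (circle R)) : measurable A ->
  @haar_circle R A = uniform_prob (@ltr01 R) (@circle_pi R @^-1` A).
Proof.
move=> mA; set B := _ @^-1` A.
have mB : measurable (B : set R) by [].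
have -> : uniform_prob (@ltr01 R) B = (\int[uniform_prob (@ltr01 R)]_x (\1_B x)%:E)%E.
  by rewrite integral_indic// setIT.
rewrite integral_uniform//; last first.
  by apply/measurable_EFinP; exact: measurable_indic.
rewrite subr0 invr1 mul1e -integral_itv_bndo_bndc; last first.
  by apply/measurable_EFinP; exact: measurable_indic.
by rewrite integral_indic// setIC.
Qed.

Lemma Rintegral_haar_circle (f : circle R -> R) : bmfun f ->
  \int[@haar_circle R]_c f c =
  \int[uniform_prob (@ltr01 R)]_x f (circle_pi x).
Proof.
move=> bf.
have bl := @bfunctional_int_comp R _ _ _ (circle R) (@haar_circle R) id (@measurable_id _ _ _).
have bl' := bfunctional_int_comp (uniform_prob (@ltr01 R)) (@measurable_circle_pi R).
apply: (bfunctional_eq_indic bl bl' _ bf) => A mA.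
rewrite Rintegral_indic//= haar_circle_uniform//.
have mA' : measurable (@circle_pi R @^-1` A : set R) by [].
by rewrite -(@Rintegral_indic _ _ _ (uniform_prob (@ltr01 R)) _ mA').
Qed.

Lemma int_cas (k : R) : k != 0 -> cos k = 1 -> sin k = 0 ->
  \int[uniform_prob (@ltr01 R)]_x cas (k * x) = 0.
Proof.
move=> k0 ck sk.
have mck : measurable_fun setT (fun x : R => cas (k * x)).
  by apply: (measurableT_comp (@measurable_cas R)).
have bck : bmfun (fun x : R => cas (k * x)).
  by split => //; exists 2 => x; exact: cas_norm.
pose F (x : R) : R := k^-1 * (sin (k * x) - cos (k * x)) + 2 * x.
have dF (x : R) : is_derive x (1 : R) F (cas (k * x) + 2).
  rewrite /F /cas; apply: is_derive_eq.
  rewrite /GRing.scale/=; set a := cos _; set b := sin _.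
  field; exact: k0.
(* The constant 2 makes the integrand nonnegative, as the integral formula for the uniform law
   demands; its integral is subtracted at the end. *)
have : \int[uniform_prob (@ltr01 R)]_x (1 * cas (k * x) + 2) = 2.
  rewrite /Rintegral integral_uniform; last 2 first.
  - apply/measurable_EFinP; apply: measurable_funD => //.
    by apply: measurable_funM.
  - move=> x; rewrite lee_fin; have := cas_norm (k * x).
    by rewrite ler_norml mul1r => /andP[]; lra.
  rewrite subr0 invr1 mul1e (@continuous_FTC2 _ _ F)//.
  - by rewrite /F !mulr0 !mulr1 ck sk sin0 cos0 /=; ring.
  - apply: continuous_subspaceT => x; apply: cvgD; last exact: cvg_cst.
    apply: cvgMr; apply: (@continuous_comp _ _ _ ( *%R k) (@cas R)).
      exact: mulrl_continuous.
    by apply: cvgD; [exact: continuous_cos|exact: continuous_sin].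
  - split.
    + by move=> x _; have := dF x; case.
    + apply: cvg_at_right_filter; apply: differentiable_continuous.
      by apply/derivable1_diffP; have := dF 0; case.
    + apply: cvg_at_left_filter; apply: differentiable_continuous.
      by apply/derivable1_diffP; have := dF 1; case.
  - by move=> x _; rewrite derive1E; have := dF x; case=> _ ->; rewrite mul1r.
have -> : \int[uniform_prob (@ltr01 R)]_x (1 * cas (k * x) + 2) =
    1 * \int[uniform_prob (@ltr01 R)]_x cas (k * x)
    + \int[uniform_prob (@ltr01 R)]_x (2 : R).
  exact: (RintegralZD (uniform_prob (@ltr01 R)) 1 bck (bmfun_cst _ 2)).
have -> : \int[uniform_prob (@ltr01 R)]_x (2 : R) = 2.
  exact: (Rintegral_cst_prob (uniform_prob (@ltr01 R))).
lra.
Qed.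

Lemma int_ccas (n : int) : n != 0 -> \int[@haar_circle R]_c ccas (c *~ n) = 0.
Proof.
move=> n0; rewrite Rintegral_haar_circle; last first.
  split; last by exists 2 => x; exact: ccas_norm.
  by apply: measurableT_comp; [exact: measurable_ccas|exact: measurable_circleMz].
have [ck sk] := cos_sin_2piz R n.
rewrite -[RHS](int_cas (k := pi *+ 2 * n%:~R))//.
  by apply: eq_Rintegral => x _; rewrite -circle_piMz ccas_pi -mulrzl mulrA.
by rewrite mulf_neq0 ?intr_eq0// mulrn_eq0/= gt_eqF// pi_gt0.
Qed.

(** This is cas(a + b) = cas a cos b + cas(- a) sin b, which separates the two coordinates so that
    the integral factorizes. *)
Lemma tchar_split (v : int * int) x : tchar v x =
  2^-1 * (ccas (x.1 *~ v.1) * (ccas (x.2 *~ v.2) + ccas (- (x.2 *~ v.2))))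
  + 2^-1 * (ccas (- (x.1 *~ v.1)) * (ccas (x.2 *~ v.2) - ccas (- (x.2 *~ v.2)))).
Proof.
rewrite /tchar; have [a ->] := circle_piP (x.1 *~ v.1).
have [b ->] := circle_piP (x.2 *~ v.2).
rewrite -!circle_piN -circle_piD !ccas_pi mulrN mulrDr /cas cosD sinD mulrN !cosN !sinN.
by field.
Qed.

Lemma int_tchar v : v != (0, 0) -> \int[haar_torus2 R]_x tchar v x = 0.
Proof.
have bc n : bmfun (fun c : circle R => ccas (c *~ n)).
  split; last by exists 2 => x; exact: ccas_norm.
  by apply: measurableT_comp; [exact: measurable_ccas|exact: measurable_circleMz].
have bcN n : bmfun (fun c : circle R => ccas (- (c *~ n))).
  by have := bc (- n); under eq_fun do rewrite mulrNz.
have bD n : bmfun (fun c : circle R => ccas (c *~ n) + ccas (- (c *~ n))).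
  by have := bmfunZD 1 (bc n) (bcN n); under eq_fun do rewrite mul1r.
have bB n : bmfun (fun c : circle R => ccas (c *~ n) - ccas (- (c *~ n))).
  exact: bmfunB.
have i0 n : n != 0 -> \int[@haar_circle R]_c ccas (- (c *~ n)) = 0.
  move=> n0; rewrite -[RHS](@int_ccas (- n)) ?oppr_eq0//.
  by apply: eq_Rintegral => x _; rewrite mulrNz.
have bfst (f : circle R -> R) : bmfun f -> bmfun (fun x : torus2 => f x.1).
  by apply: bmfun_comp; exact: measurable_fst.
have bsnd (f : circle R -> R) : bmfun f -> bmfun (fun x : torus2 => f x.2).
  by apply: bmfun_comp; exact: measurable_snd.
move=> v0; under eq_Rintegral do rewrite tchar_split.
rewrite RintegralZD; last 2 first.
  by apply: bmfunM; [exact: (bfst _ (bc v.1))|exact: (bsnd _ (bD v.2))].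
  by apply: bmfunM; [exact: bmfun_cst|apply: bmfunM;
    [exact: (bfst _ (bcN v.1))|exact: (bsnd _ (bB v.2))]].
rewrite RintegralZl//; last first.
  apply: bmfun_integrable; apply: bmfunM;
    [exact: (bfst _ (bcN v.1))|exact: (bsnd _ (bB v.2))].
rewrite (Rintegral_prod _ _ (bc v.1) (bD v.2)) (Rintegral_prod _ _ (bcN v.1) (bB v.2)).
have [v10|v10] := eqVneq v.1 0; last by rewrite int_ccas// i0//; lra.
have v20 : v.2 != 0.
  by apply: contra_neq v0 => v20; rewrite (surjective_pairing v) v10 v20.
have -> : \int[@haar_circle R]_c (ccas (c *~ v.2) + ccas (- (c *~ v.2))) = 0.
  have := RintegralZD (@haar_circle R) 1 (bc v.2) (bcN v.2).
  under eq_Rintegral do rewrite mul1r.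
  by move=> ->; rewrite int_ccas// i0//; lra.
have -> : \int[@haar_circle R]_c (ccas (c *~ v.2) - ccas (- (c *~ v.2))) = 0.
  have := RintegralZD (@haar_circle R) (-1) (bcN v.2) (bc v.2).
  under eq_Rintegral do rewrite mulN1r addrC.
  by move=> ->; rewrite int_ccas// i0//; lra.
by lra.
Qed.

Lemma measurable_torus2_action g : measurable_fun setT (@torus2_action R g).
Proof.
apply: measurable_fun_pair; apply: measurable_circleD; apply: measurable_circleMz.
- exact: measurable_fst.
- exact: measurable_snd.
- exact: measurable_fst.
- exact: measurable_snd.
Qed.

(** By totality only characters have to be integrated. Their integrals vanish except at v = 0, and
    the dual action fixes 0 and maps nothing else to it. *)
Lemma torus2_action_preserving g :
  measure_preserving (haar_torus2 R) (haar_torus2 R) (@torus2_action R g).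
Proof.
apply: measure_preservingP; first exact: measurable_torus2_action.
move=> B mB.
have bl := bfunctional_int_comp (haar_torus2 R) (measurable_torus2_action g).
have bl' := @bfunctional_int_comp R _ _ _ torus2 (haar_torus2 R) id (@measurable_id _ _ _).
have bL := bclosed_eq_bfunctional bl bl'.
have [] : [set f : torus2 -> R | bmfun f /\ \int[haar_torus2 R]_x f (torus2_action g x)
    = \int[haar_torus2 R]_x f x] \1_B.
  apply: (bclosed_tchar bL); last exact: bmfun_indic.
  move=> v; split; first exact: bmfun_tchar.
  under eq_Rintegral do rewrite tchar_action.
  have [->|v0] := eqVneq v (0, 0); first by rewrite int2_action0.
  by rewrite !int_tchar// int2_action_eq0.
by [].
Qed.

End torus_theory.

(** * Conditional expectation and mixing of the Bernoulli shift *)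

Section density.
Context (R : realType) d (T : measurableType d) (m : probability T R).

Lemma Rintegral_indicM (A : set T) (f : T -> R) :
  \int[m]_x (\1_A x * f x) = \int[m]_(x in A) f x.
Proof.
rewrite [RHS]Rintegral_mkcond; apply: eq_Rintegral => x _.
by rewrite patchE indicE; case: ifP => _; rewrite ?mul1r ?mul0r.
Qed.

(** On the set where f > M the integral of |f - M| equals that of f - M, which is at most 0 by
    hypothesis; hence f = M almost everywhere on it. *)
Lemma ae_le_of_integral (f : T -> R) (M : R) :
  m.-integrable setT (EFin \o f) ->
  (forall A, measurable A -> (\int[m]_(x in A) (f x)%:E <= M%:E * m A)%E) ->
  {ae m, forall x, f x <= M}.
Proof.
move=> intf h.
have mf : measurable_fun setT f by apply/measurable_EFinP; exact: measurable_int intf.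
pose A := [set x | M < f x].
have mA : measurable A.
  rewrite -[A]setTI; have := measurable_fun_ltr (measurable_cst M) mf.
  move=> /(_ measurableT [set true]); rewrite /A; apply => //.
have intfA : m.-integrable A (EFin \o f) by apply: integrableS intf.
have intM : m.-integrable A (EFin \o cst M).
  by apply: integrableS (bmfun_integrable m (bmfun_cst T M)).
pose g x : R := f x - M.
have mg : measurable_fun A (EFin \o g).
  by apply: measurable_funTS; apply/measurable_EFinP; exact: measurable_funB.
have g0 : (\int[m]_(x in A) `|(EFin \o g) x| = 0)%E.
  apply/eqP; rewrite eq_le integral_ge0// andbT.
  have -> : (\int[m]_(x in A) `|(EFin \o g) x| =
      \int[m]_(x in A) (f x)%:E - \int[m]_(x in A) M%:E)%E.
    rewrite -integralB//; apply: eq_integral => x; rewrite inE => Ax.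
    by rewrite /= -EFinB ger0_norm// subr_ge0 ltW.
  rewrite integral_cst// sube_le0; exact: h.
have /(ae_eq_integral_abs m mA mg) := g0.
rewrite /ae_eq; apply: filterS => x /= hx.
rewrite leNgt; apply/negP => Mx.
have := hx Mx; rewrite /g => -[] /eqP; rewrite subr_eq0 => /eqP fM.
by move: Mx; rewrite fM ltxx.
Qed.

Lemma bmfun_ae_eq (f g : T -> R) : bmfun f -> bmfun g ->
  (forall A, measurable A -> \int[m]_x (\1_A x * f x) = \int[m]_x (\1_A x * g x)) ->
  {ae m, forall x, f x = g x}.
Proof.
move=> bf bg h.
have fi := bmfun_integrable m bf; have gi := bmfun_integrable m bg.
have : ae_eq m setT (EFin \o f) (EFin \o g).
  apply: integral_ae_eq => //; first by case/integrableP: gi.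
  move=> E _ mE.
  rewrite -[LHS]fineK ?integrable_fin_num//; last exact: integrableS fi.
  rewrite -[RHS]fineK ?integrable_fin_num//; last exact: integrableS gi.
  by congr EFin; have := h E mE; rewrite !Rintegral_indicM.
by apply: filterS => x /(_ I) [].
Qed.

Lemma le_integral_cst (f : T -> R) (M : R) A : measurable A ->
  m.-integrable setT (EFin \o f) -> (forall x, f x <= M) ->
  (\int[m]_(x in A) (f x)%:E <= M%:E * m A)%E.
Proof.
move=> mA fi fM; rewrite -integral_cst//; apply: le_integral => //.
- by apply: integrableS fi.
- exact: integrableS (bmfun_integrable m (bmfun_cst T M)).
- by move=> x _; rewrite lee_fin.
Qed.

End density.

Section conditional_expectation.
Context (R : realType) d (T : measurableType d) d' (U : measurableType d').
Variables (m : probability T R) (eta : probability U R).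
Variable p : T -> U.
Hypothesis pp : measure_preserving m eta p.

(** phi is the Radon-Nikodym derivative, with respect to eta, of the image under p of the charge
    with density F. It lives on U, so that being measurable over the factor is part of its type. *)
Lemma cond_exp (F : T -> R) : bmfun F -> exists phi : U -> R, bmfun phi /\
  forall f, bmfun f -> \int[m]_x (f (p x) * F x) = \int[eta]_u (f u * phi u).
Proof.
move=> bF; have mp := pp.1; have intF := bmfun_integrable m bF.
case: (bF) => mF [M FM].
have mpi A : measurable A -> measurable (p @^-1` A).
  by move=> mA; rewrite -[X in measurable X]setTI; exact: mp.
pose nu0 : set U -> \bar R := fun A => induced_charge intF (p @^-1` A).
have h0 : nu0 set0 = 0%E by rewrite /nu0 preimage_set0 /induced_charge integral_set0.
have hf A : measurable A -> nu0 A \is a fin_num.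
  by move=> mA; apply: integrable_fin_num; [exact: mpi|
    exact: (integrableS measurableT (mpi _ mA) _ intF)].
have hs : semi_sigma_additive nu0.
  move=> E mE tE mUE; rewrite /nu0 preimage_bigcup.
  apply: (@charge_semi_sigma_additive _ _ _ (induced_charge intF)).
  - by move=> n; exact: mpi.
  - apply/trivIsetP => /= i j _ _ ij; rewrite -preimage_setI.
    by move/trivIsetP : tE => /(_ _ _ _ _ ij) ->//; rewrite preimage_set0.
  - by rewrite -preimage_bigcup; exact: mpi.
pose c := isCharge.Build _ _ _ nu0 h0 hf hs.
pose nu : {charge set U -> \bar R} := HB.pack nu0 c.
have dom : nu `<< eta.
  apply/null_content_dominatesP => A mA etaA.
  rewrite /= /nu0 /induced_charge; apply: null_set_integral => //.
  - exact: mpi.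
  - by apply: measurable_funTS; exact: measurable_int intF.
  - exact: etrans (pp.2 _ mA) etaA.
pose phie := Radon_Nikodym nu eta.
have phi_int : eta.-integrable setT phie := Radon_Nikodym_integrable dom.
pose phi0 := fine \o phie.
have phi0E : EFin \o phi0 = phie.
  by apply/funext => x; rewrite /= fineK//; exact: Radon_Nikodym_fin_num.
have phi0A A : measurable A ->
    (\int[eta]_(x in A) (phi0 x)%:E = \int[m]_(x in p @^-1` A) (F x)%:E)%E.
  move=> mA; transitivity (nu A) => //.
  by rewrite (Radon_Nikodym_integral dom mA) -/phie -phi0E.
have phi0_int : eta.-integrable setT (EFin \o phi0) by rewrite phi0E.
have mphi0 : measurable_fun setT phi0.
  by apply/measurable_EFinP; exact: measurable_int phi0_int.
have le1 : {ae eta, forall x, phi0 x <= M}.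
  apply: ae_le_of_integral => // A mA.
  rewrite phi0A// -(pp.2 _ mA); apply: le_integral_cst => //; first exact: mpi.
  by move=> x; rewrite (le_trans (ler_norm _)).
have le2 : {ae eta, forall x, -1 * phi0 x <= M}.
  have Nint : eta.-integrable setT (EFin \o (fun x => -1 * phi0 x)).
    by have := integrableZl measurableT (-1) phi0_int.
  have NintF : m.-integrable setT (EFin \o (fun x => -1 * F x)).
    by have := integrableZl measurableT (-1) intF.
  apply: ae_le_of_integral => // A mA.
  have mpA := mpi _ mA.
  under eq_integral do rewrite EFinM.
  rewrite integralZl//; last by apply: integrableS phi0_int.
  rewrite phi0A// -integralZl//; last by apply: (integrableS measurableT mpA _ intF).
  rewrite -(pp.2 _ mA); apply: (le_integral_cst (f := fun x => -1 * F x)) => //.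
  by move=> x; have := FM x; rewrite ler_norml => /andP[]; lra.
(* The derivative is bounded by M only almost everywhere; truncation yields a version bounded
   everywhere. *)
pose phi x := Num.max (- M) (Num.min M (phi0 x)).
have phiE : {ae eta, forall x, phi0 x = phi x}.
  move: le1 le2; apply: filterS2 => x h1 h2.
  by rewrite /phi min_r// max_r//; lra.
have bphi : bmfun phi.
  split.
    by apply: measurable_maxr => //; exact: measurable_minr.
  exists `|M| => x; rewrite /phi /Num.max /Num.min.
  have := ler_norm M; have := ler_norm (- M); rewrite normrN => h1 h2.
  by rewrite ler_norml; case: ifP; case: ifP => //; lra.
exists phi; split => //.
have bl := bfunctional_int m mp bF.
have bl' := @bfunctional_int R _ U _ U eta id phi (@measurable_id _ _ _) bphi.
apply: (bfunctional_eq_indic bl bl') => A mA.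
have -> : \int[m]_x (\1_A (p x) * F x) = \int[m]_(x in p @^-1` A) F x.
  by rewrite -[RHS]Rintegral_indicM; apply: eq_Rintegral => x _; rewrite !indicE.
have -> : \int[eta]_u (\1_A (id u) * phi u) = \int[eta]_(u in A) phi u.
  rewrite [RHS]Rintegral_mkcond; apply: eq_Rintegral => x _.
  by rewrite patchE indicE; case: ifP => _; rewrite ?mul1r ?mul0r.
congr fine; rewrite -phi0A//; apply: ae_eq_integral => //.
- by apply: measurable_funTS; apply/measurable_EFinP.
- by apply: measurable_funTS; apply/measurable_EFinP; case: bphi.
- by move: phiE; apply: filterS => x -> .
Qed.

End conditional_expectation.

(** * Product measures *)

Section products.
Context (R : realType).

Lemma bclosed_mul_comp (T U : Type) (L : set (T -> R)) (p : T -> U) (h : T -> R) (N : R) :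
  (forall x, `|h x| <= N) -> bclosed L ->
  bclosed [set f : U -> R | L (fun x => f (p x) * h x)].
Proof.
move=> hN [L1 L2]; split => /=.
  move=> a f g Lf Lg; have := L1 a _ _ Lf Lg; congr L; apply/funext => x; ring.
move=> F f M LF FM Ff; apply: (L2 _ _ (M * N) LF) => n.
  by move=> ?; rewrite normrM ler_pM.
by apply: cvgMl; exact: Ff.
Qed.

Context d1 d2 (Y : measurableType d1) (X : measurableType d2).

Lemma indic_setX (A : set Y) (B : set X) (w : Y * X) :
  \1_(A `*` B) w = \1_A w.1 * \1_B w.2 :> R.
Proof. by rewrite !indicE -natrM mulnb -in_setX; case: w. Qed.

Lemma normr_indic (T : Type) (A : set T) x : `|\1_A x| <= 1 :> R.
Proof. by rewrite indicE; case: (_ \in _); rewrite ?normr1 ?normr0. Qed.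

(** Dynkin's argument runs twice: in the first coordinate with B fixed, then from rectangles to all
    measurable sets. The generating family G is there for the cylinders of a power space. *)
Lemma bclosed_setX (L : set (Y * X -> R)) (G : set (set Y)) :
  @measurable _ Y = <<s G >> -> setI_closed G -> G setT -> bclosed L ->
  (forall A B, G A -> measurable B -> L (fun w => \1_A w.1 * \1_B w.2)) ->
  forall S, measurable S -> L \1_S.
Proof.
move=> GE GI GT bL LG.
have LR A B : measurable A -> measurable B -> L (fun w => \1_A w.1 * \1_B w.2).
  move=> mA mB.
  have bL' := bclosed_mul_comp (@fst Y X)
    (fun w : Y * X => normr_indic B w.2) bL.
  apply: (bclosed_dynkin GE GI bL' _ _ mA) => /=.
    by have := LG _ _ GT mB; rewrite indicT.
  by move=> C GC; exact: LG.
apply: (bclosed_dynkin (measurable_prod_measurableType Y X)).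
- move=> _ _ [A mA [B mB <-]] [A' mA' [B' mB' <-]].
  exists (A `&` A'); first exact: measurableI.
  exists (B `&` B'); first exact: measurableI.
  by rewrite setXI.
- exact: bL.
- have := LR _ _ measurableT measurableT; rewrite !indicT.
  by under eq_fun do rewrite mulr1.
- move=> _ [A mA [B mB <-]]; have := LR _ _ mA mB; congr L; apply/funext => w.
  by rewrite indic_setX.
Qed.

End products.

Lemma bmfun_ae_eq_setX (R : realType) d1 d2 (Y : measurableType d1)
    (X : measurableType d2) (m : probability (Y * X)%type R) (f g : Y * X -> R) :
  bmfun f -> bmfun g ->
  (forall A B, measurable A -> measurable B ->
     \int[m]_w (\1_A w.1 * \1_B w.2 * f w) = \int[m]_w (\1_A w.1 * \1_B w.2 * g w)) ->
  {ae m, forall w, f w = g w}.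
Proof.
move=> bf bg h; apply: bmfun_ae_eq => // S mS.
have bl := @bfunctional_int R _ _ _ (Y * X)%type m id _ (@measurable_id _ _ _) bf.
have bl' := @bfunctional_int R _ _ _ (Y * X)%type m id _ (@measurable_id _ _ _) bg.
have bL := bclosed_eq_bfunctional bl bl'.
have GE : @measurable _ Y = <<s measurable >>.
  by rewrite sigma_algebra_id//; exact: sigma_algebra_measurable.
have [] : [set F : Y * X -> R | bmfun F /\
    \int[m]_w (F w * f w) = \int[m]_w (F w * g w)] \1_S; last by [].
apply: (bclosed_setX GE (@measurableI _ Y) measurableT bL) => // A B mA mB.
split; last exact: h.
apply: bmfunM.
  by apply: bmfun_comp (bmfun_indic R mA); exact: measurable_fst.
by apply: bmfun_comp (bmfun_indic R mB); exact: measurable_snd.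
Qed.

Lemma measure_preserving_prod (R : realType) d1 d2 d3 d4 (T1 : measurableType d1)
    (T2 : measurableType d2) (U1 : measurableType d3) (U2 : measurableType d4)
    (m1 : probability T1 R) (m2 : probability T2 R) (n1 : probability U1 R)
    (n2 : probability U2 R) (p1 : T1 -> U1) (p2 : T2 -> U2) :
  measure_preserving m1 n1 p1 -> measure_preserving m2 n2 p2 ->
  measure_preserving (m1 \x m2)%E (n1 \x n2)%E (fun w => (p1 w.1, p2 w.2)).
Proof.
move=> pp1 pp2.
have mp : measurable_fun setT (fun w : T1 * T2 => (p1 w.1, p2 w.2)).
  apply: measurable_fun_pair.
    exact: measurableT_comp pp1.1 measurable_fst.
  exact: measurableT_comp pp2.1 measurable_snd.
apply: measure_preservingP => //.
have bL := bclosed_eq_bfunctional (bfunctional_int_comp (m1 \x m2)%E mp)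
   (@bfunctional_int_comp R _ _ _ (U1 * U2)%type (n1 \x n2)%E id (@measurable_id _ _ _)).
move=> S mS.
have [] : [set f : U1 * U2 -> R | bmfun f /\
    \int[(m1 \x m2)%E]_x f (p1 x.1, p2 x.2) = \int[(n1 \x n2)%E]_x f x] \1_S; last by [].
apply: (bclosed_setX (G := measurable)) => //.
- by rewrite sigma_algebra_id//; exact: sigma_algebra_measurable.
- exact: measurableI.
- move=> A B mA mB; split.
    apply: bmfunM.
      apply: bmfun_comp (bmfun_indic _ mA); exact: measurable_fst.
    apply: bmfun_comp (bmfun_indic _ mB); exact: measurable_snd.
  have bA := bmfun_indic R mA; have bB := bmfun_indic R mB.
  rewrite (Rintegral_prod _ _ bA bB).
  rewrite (Rintegral_prod _ _ (bmfun_comp pp1.1 bA) (bmfun_comp pp2.1 bB)).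
  by rewrite (Rintegral_preserving pp1)// (Rintegral_preserving pp2).
Qed.

Lemma measure_preserving_snd (R : realType) d1 d2 (Y : measurableType d1)
    (X : measurableType d2) (nu : probability Y R) (mu : probability X R) :
  measure_preserving (nu \x mu)%E mu snd.
Proof.
apply: measure_preservingP; first exact: measurable_snd.
move=> A mA; have := Rintegral_prod nu mu (bmfun_cst Y 1) (bmfun_indic R mA).
rewrite Rintegral_cst_prob mul1r => <-.
by apply: eq_Rintegral => w _; rewrite mul1r.
Qed.

(** * Cylinders and asymptotic independence *)

Section power_space.
Context (R : realType) (I : choiceType) d (T : measurableType d).
Local Notation Y := (power_space I T).
Implicit Types (s : seq I) (B : I -> set T).

Definition fcyl s B : set Y := [set y | forall i, i \in s -> B i (y i)].

Definition fcyls : set (set Y) :=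
  [set A | exists s B, [/\ uniq s, forall i, measurable (B i) & A = fcyl s B]].

Lemma fcylsT : fcyls setT.
Proof.
exists [::], (fun=> setT); split => //.
by apply/seteqP; split => // y _ i.
Qed.

Lemma fcyl_catE s s' B B' : (forall i, i \in s' -> i \notin s) ->
  fcyl s B `&` fcyl s' B' = fcyl (s ++ s') (fun i => if i \in s then B i else B' i).
Proof.
move=> dis; apply/seteqP; split => y /=.
  by move=> [h h'] i; rewrite mem_cat; case: ifPn => [/h|is_ /= /h'].
move=> h; split => i is_; have := h i; rewrite mem_cat is_ ?orbT; last first.
  by rewrite (negbTE (dis _ is_)); apply.
by apply.
Qed.

Lemma fcylsI : setI_closed fcyls.
Proof.
move=> _ _ [s [B [us mB ->]]] [s' [B' [us' mB' ->]]].
(* The default [setT] leaves an index of one list free of the constraints of the other. *)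
exists (undup (s ++ s')), (fun i => (if i \in s then B i else setT) `&`
  (if i \in s' then B' i else setT)); split.
- exact: undup_uniq.
- by move=> i; apply: measurableI; case: ifP.
- apply/seteqP; split => y /=.
    by move=> [h h'] i _; split; case: ifP => // is_; [exact: h|exact: h'].
  move=> h; split => i is_; have := h i; rewrite mem_undup mem_cat is_ ?orbT/=.
    by move=> /(_ isT)[].
  by move=> /(_ isT)[].
Qed.

Lemma measurable_coord i : measurable_fun setT (fun y : Y => y i).
Proof.
move=> _ A mA; rewrite setTI; apply: sub_gen_smallest.
by exists i, A.
Qed.

Lemma measurable_fcyl s B : (forall i, measurable (B i)) -> measurable (fcyl s B).
Proof.
move=> mB; elim: s => [|i s ih].
  have -> : fcyl [::] B = setT by apply/seteqP; split.
  exact: measurableT.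
have -> : fcyl (i :: s) B = (fun y : Y => y i) @^-1` B i `&` fcyl s B.
  apply/seteqP; split => y /=.
    by move=> h; split => [|j js]; apply: h; rewrite inE ?eqxx// js orbT.
  by move=> [h1 h2] j; rewrite inE => /orP[/eqP ->//|/h2].
by apply: measurableI => //; rewrite -[X in measurable X]setTI; exact: measurable_coord.
Qed.

Lemma measurable_fcyls : @measurable _ Y = <<s fcyls >>.
Proof.
apply/seteqP; split.
  apply: smallest_sub; first exact: smallest_sigma_algebra.
  move=> _ [i [B mB ->]]; apply: sub_gen_smallest.
  exists [:: i], (fun=> B); split => //.
  apply/seteqP; split => y /=; first by move=> h j; rewrite inE => /eqP ->.
  by apply; rewrite mem_head.
apply: smallest_sub; first exact: sigma_algebra_measurable.
by move=> _ [s [B [us mB ->]]]; exact: measurable_fcyl.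
Qed.

Lemma measurable_power_fun d' (M : measurableType d') (f : M -> Y) :
  (forall i, measurable_fun setT (fun x => f x i)) -> measurable_fun setT f.
Proof.
move=> mf; apply: (@measurability _ _ _ Y setT f (@cylinders I d T) erefl).
by move=> _ [_ [i [B mB ->]] <-]; exact: mf.
Qed.

Context (mu0 : probability T R) (nu : probability Y R).
Hypothesis hnu : is_power_measure mu0 nu.

Lemma fcyl_indep s s' B B' : uniq s -> uniq s' ->
  (forall i, measurable (B i)) -> (forall i, measurable (B' i)) ->
  (forall i, i \in s' -> i \notin s) ->
  nu (fcyl s B `&` fcyl s' B') = (nu (fcyl s B) * nu (fcyl s' B'))%E.
Proof.
move=> us us' mB mB' dis; rewrite fcyl_catE// !hnu//; last 2 first.
- by rewrite cat_uniq us us'/= andbT; apply/hasPn => i /dis.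
- by move=> i; case: ifP.
rewrite big_cat/=; congr (_ * _)%E.
  by rewrite big_seq [RHS]big_seq; apply: eq_bigr => i ->.
rewrite big_seq [RHS]big_seq; apply: eq_bigr => i /dis /negbTE ->//.
Qed.

Context dX (X : measurableType dX) (mu : probability X R).
Local Notation m := (nu \x mu)%E.

(** A covariance of F with C, localized to A. It vanishes for all C and A when F depends on the
    X-coordinate only, and its vanishing is how such functions are recognized. *)
Definition decorr (F : Y * X -> R) (C : set Y) (A : set X) : R :=
  \int[m]_w (F w * (\1_C w.1 * \1_A w.2)) - fine (nu C) * \int[m]_w (F w * \1_A w.2).

Let bC (C : set Y) : measurable C -> bmfun (fun w : Y * X => \1_C w.1 : R).
Proof. by move=> mC; apply: bmfun_comp (bmfun_indic R mC); exact: measurable_fst. Qed.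

Let bA (A : set X) : measurable A -> bmfun (fun w : Y * X => \1_A w.2 : R).
Proof. by move=> mA; apply: bmfun_comp (bmfun_indic R mA); exact: measurable_snd. Qed.

Lemma decorrZD a F H C A : bmfun F -> bmfun H -> measurable C -> measurable A ->
  decorr (fun w => a * F w + H w) C A = a * decorr F C A + decorr H C A.
Proof.
move=> bF bH mC mA; rewrite /decorr.
under eq_Rintegral do rewrite mulrDl -mulrA.
rewrite RintegralZD; [|by do 2?apply: bmfunM => //; [exact: bC|exact: bA]..].
under [X in _ - _ * X]eq_Rintegral do rewrite mulrDl -mulrA.
rewrite RintegralZD; [|by apply: bmfunM => //; exact: bA..].
by ring.
Qed.

(** The bound is the same for all C and A, so an L1-approximation of F controls all of them at
    once. *)
Lemma decorr_norm F C A : bmfun F -> measurable C -> measurable A ->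
  `|decorr F C A| <= 2 * \int[m]_w `|F w|.
Proof.
move=> bF mC mA.
have H (h : Y * X -> R) : bmfun h -> (forall w, `|h w| <= 1) ->
    `|\int[m]_w (F w * h w)| <= \int[m]_w `|F w|.
  move=> bh h1; apply: le_trans.
    apply: le_normr_Rintegral => //; apply: bmfun_integrable; exact: bmfunM.
  apply: le_Rintegral => //.
  - by apply: bmfun_integrable; apply: bmfun_norm; exact: bmfunM.
  - by apply: bmfun_integrable; apply: bmfun_norm.
  - by move=> w _; rewrite normrM ler_piMr.
have nC : `|fine (nu C)| <= 1.
  rewrite ger0_norm ?fine_ge0// -lee_fin fineK ?fin_num_measure//.
  exact: probability_le1.
rewrite /decorr (le_trans (ler_normB _ _))//.
have h1 := H _ (bmfunM (bC mC) (bA mA)).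
have h2 := H _ (bA mA) (fun w => normr_indic R A w.2).
have {}h1 : `|\int[m]_w (F w * (\1_C w.1 * \1_A w.2))| <= \int[m]_w `|F w|.
  by apply: h1 => w; rewrite normrM mulr_ile1// normr_indic.
rewrite normrM.
have : `|fine (nu C)| * `|\int[m]_w (F w * \1_A w.2)| <= 1 * \int[m]_w `|F w|.
  by rewrite ler_pM.
by rewrite mul1r => h; rewrite mulr_natl mulr2n lerD.
Qed.

(* Uniformity in A is needed because g moves A together with the cylinder. *)
Definition asymp_indep : set (Y * X -> R) := [set F | bmfun F /\
  forall e : R, 0 < e -> exists s, forall s' B A, uniq s' ->
    (forall i, i \in s' -> i \notin s) -> (forall i, measurable (B i)) ->
    measurable A -> `|decorr F (fcyl s' B) A| <= e].

Lemma bclosed_asymp_indep : bclosed asymp_indep.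
Proof.
split.
  move=> a F H [bF iF] [bH iH]; split; first exact: bmfunZD.
  (* The summand 1 covers a = 0; multiplied by |a|, this tolerance is at most e / 2. *)
  move=> e e0; have ea : 0 < e / (2 * (`|a| + 1)).
    by rewrite divr_gt0// mulr_gt0// ltr_wpDl.
  have e2 : 0 < e / 2 by rewrite divr_gt0.
  have [s hs] := iF _ ea; have [t ht] := iH _ e2.
  exists (s ++ t) => s' B A us' dis mB mA.
  have mC := measurable_fcyl s' mB.
  rewrite decorrZD// (le_trans (ler_normD _ _))// normrM.
  have h1 : `|decorr F (fcyl s' B) A| <= e / (2 * (`|a| + 1)).
    by apply: hs => // i /dis; rewrite mem_cat negb_or => /andP[].
  have h2 : `|decorr H (fcyl s' B) A| <= e / 2.
    by apply: ht => // i /dis; rewrite mem_cat negb_or => /andP[].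
  have h3 : `|a| * `|decorr F (fcyl s' B) A| <= `|a| * (e / (2 * (`|a| + 1))).
    by rewrite ler_wpM2l.
  have h4 : `|a| * (e / (2 * (`|a| + 1))) <= e / 2.
    have a1 : 0 < `|a| + 1 by rewrite ltr_wpDl.
    rewrite mulrCA ler_wpM2l ?(ltW e0)// ler_pdivrMr ?mulr_gt0//.
    by rewrite mulrA mulVf// mul1r lerDl.
  lra.
move=> F f M iF FM Ff; have bF n := (iF n).1; have bf := bmfun_lim bF FM Ff.
split => // e e0.
have h : \int[m]_w `|F n w - f w| @[n --> \oo] --> (0 : R).
  have -> : 0 = \int[m]_w (0 : R) by rewrite Rintegral_cst_prob.
  apply: (@bounded_convergence _ _ _ m _ _ (M + M)).
  - by move=> n; apply: bmfun_norm; exact: bmfunB.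
  - move=> n w; rewrite normr_id (le_trans (ler_normB _ _))// lerD//.
    rewrite -(cvg_lim _ (cvg_norm (Ff w)))//.
    by apply: limr_le; [apply/cvg_ex; eexists; exact: cvg_norm (Ff w)|exact: nearW].
  - move=> w; have h : F n w - f w @[n --> \oo] --> f w - f w.
      by apply: cvgB; [exact: Ff|exact: cvg_cst].
    by rewrite (_ : 0 = `|f w - f w|); [exact: cvg_norm|rewrite subrr normr0].
(* The bound of [decorr_norm] doubles the L1-distance, so e / 4 costs e / 2. *)
have e4 : 0 < e / 4 by rewrite divr_gt0.
have /cvgr0Pnorm_lt/(_ _ e4) [n _ /(_ n (leqnn n))] := h.
rewrite /= ger0_norm ?Rintegral_ge0// => hn.
have e2 : 0 < e / 2 by rewrite divr_gt0.
have [s hs] := (iF n).2 _ e2.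
exists s => s' B A us' dis mB mA; have mC := measurable_fcyl s' mB.
have {}hs := hs s' B A us' dis mB mA.
have := decorrZD (-1) (bmfunB (bF n) bf) (bF n) mC mA.
have -> : (fun w => -1 * (F n w - f w) + F n w) = f by apply/funext => w; ring.
move=> ->; have := decorr_norm (bmfunB (bF n) bf) mC mA.
move: hn hs; set a := \int[_]_w _; set b := decorr _ _ _; set c := decorr _ _ _.
move: a b c => a b c; clear -e0 => hn hs.
rewrite !ler_norml in hs *; move=> /andP[? ?]; move/andP: hs => [? ?].
apply/andP; split; lra.
Qed.

(** For a cylinder times a set of X the witness is the list of its own coordinates: against
    cylinders over other coordinates the decorrelation is exact. Such rectangles generate. *)
Lemma asymp_indep_indic S : measurable S -> asymp_indep \1_S.
Proof.
apply: (bclosed_setX measurable_fcyls fcylsI fcylsT bclosed_asymp_indep).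
move=> _ A [s [B [us mB ->]]] mA.
have mC := measurable_fcyl s mB.
split; first by apply: bmfunM; [exact: bC|exact: bA].
move=> e e0; exists s => s' B' A' us' dis mB' mA'; have mC' := measurable_fcyl s' mB'.
suff -> : decorr (fun w => \1_(fcyl s B) w.1 * \1_A w.2) (fcyl s' B') A' = 0.
  by rewrite normr0 ltW.
rewrite /decorr.
have -> : \int[m]_w (\1_(fcyl s B) w.1 * \1_A w.2 * (\1_(fcyl s' B') w.1 * \1_A' w.2)) =
    \int[m]_w (\1_(fcyl s B `&` fcyl s' B') w.1 * \1_(A `&` A') w.2) :> R.
  by apply: eq_Rintegral => w _; rewrite !indicI/= /GRing.mul_fun; ring.
have -> : \int[m]_w (\1_(fcyl s B) w.1 * \1_A w.2 * \1_A' w.2) =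
    \int[m]_w (\1_(fcyl s B) w.1 * \1_(A `&` A') w.2) :> R.
  by apply: eq_Rintegral => w _; rewrite !indicI/= /GRing.mul_fun; ring.
have mCC := measurableI _ _ mC mC'; have mAA := measurableI _ _ mA mA'.
rewrite !Rintegral_prod; [|exact: bmfun_indic..].
rewrite !Rintegral_indic// fcyl_indep// fineM ?fin_num_measure//.
ring.
Qed.

End power_space.

(** * Invariant sets of the diagonal action *)

Section bernoulli.
Context (R : realType) (G : groupType) d (T : measurableType d).
Local Notation Y := (power_space G T).
Context (mu0 : probability T R) (nu : probability Y R).
Hypothesis hnu : is_power_measure mu0 nu.

Lemma measurable_bernoulli_shift g : measurable_fun setT (@bernoulli_shift G _ T g).
Proof. by apply: measurable_power_fun => h; exact: measurable_coord. Qed.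

Lemma bernoulli_shift_action : is_action (@bernoulli_shift G _ T).
Proof.
split=> [y|g h y]; apply/funext => k; rewrite /bernoulli_shift.
  by rewrite invg1 mul1g.
by rewrite invgM mulgA.
Qed.

Lemma bernoulli_shift_fcyl g s (B : G -> set T) :
  @bernoulli_shift G _ T g @^-1` fcyl s B =
  fcyl [seq (g^-1 * i)%g | i <- s] (fun i => B (g * i)%g).
Proof.
apply/seteqP; split => y /=.
  by move=> h _ /mapP[i is_ ->]; rewrite mulgA mulgV mul1g; exact: h.
move=> h i is_; have := h (g^-1 * i)%g; rewrite mulgA mulgV mul1g; apply.
exact: map_f.
Qed.

Lemma bernoulli_shift_preserving g :
  measure_preserving nu nu (@bernoulli_shift G _ T g).
Proof.
have ms := measurable_bernoulli_shift g.
apply: measure_preservingP => // A mA.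
have bl := bfunctional_int_comp nu ms.
have bl' := @bfunctional_int_comp R _ _ _ Y nu id (@measurable_id _ _ _).
apply: (bfunctional_eq_dynkin (@measurable_fcyls G _ T) (@fcylsI G _ T) bl bl' _ _
  (bmfun_indic R mA)) => // _ [s [B [us mB ->]]] /=.
have mC := measurable_fcyl s mB.
have mC' : measurable (@bernoulli_shift G _ T g @^-1` fcyl s B).
  by rewrite -[X in measurable X]setTI; exact: ms.
transitivity (\int[nu]_x \1_(@bernoulli_shift G _ T g @^-1` fcyl s B) x : R).
  by apply: eq_Rintegral => x _; rewrite !indicE.
rewrite !Rintegral_indic//; congr fine.
rewrite bernoulli_shift_fcyl !hnu//; last by rewrite map_inj_uniq//; exact: mulgI.
by rewrite big_map; apply: eq_bigr => i _; rewrite mulgA mulgV mul1g.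
Qed.

Context dX (X : measurableType dX) (mu : probability X R) (b : G -> X -> X).
Hypothesis bact : is_action b.
Hypothesis bpres : forall g, measure_preserving mu mu (b g).
Local Notation m := (nu \x mu)%E.
Local Notation D := (diag_action (@bernoulli_shift G _ T) b).

Lemma diag_preserving g : measure_preserving m m (D g).
Proof. exact: measure_preserving_prod (bernoulli_shift_preserving g) (bpres g). Qed.

Lemma diag_actionK g w : D g^-1 (D g w) = w.
Proof.
case: w => y x; rewrite /diag_action/= -(bernoulli_shift_action.2) -bact.2.
by rewrite mulVg bernoulli_shift_action.1 bact.1.
Qed.

Lemma int_invariant g (S : set (Y * X)) (h : Y * X -> R) : measurable S ->
  {ae m, forall w, S (D g w) <-> S w} -> bmfun h ->
  \int[m]_w (\1_S w * h w) = \int[m]_w (\1_S w * h (D g^-1 w)).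
Proof.
move=> mS inv bh.
have mDg := (diag_preserving g).1; have mDV := (diag_preserving g^-1).1.
have bS := bmfun_indic R mS.
transitivity (\int[m]_w (\1_S (D g w) * h w)).
  congr fine; apply: ae_eq_integral => //.
  - by apply/measurable_EFinP; case: (bmfunM bS bh).
  - by apply/measurable_EFinP; case: (bmfunM (bmfun_comp mDg bS) bh).
  - move: inv; apply: filterS => w iw _; congr (_%:E); congr (_ * _).
    by rewrite !indicE; congr (_%:R); congr nat_of_bool; apply/idP/idP; rewrite !inE => /iw.
rewrite -(Rintegral_preserving (diag_preserving g) (bmfunM bS (bmfun_comp mDV bh))).
by apply: eq_Rintegral => w _; rewrite diag_actionK.
Qed.

(** Moving C and A by an element that preserves S does not change the quantity. Such an element can
    be chosen to push the coordinates of C off the finite list attached to e, where the quantity is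
    at most e. *)
Lemma invariant_decorr S (C : set Y) (A : set X) : measurable S ->
  (forall s s' : seq G, exists g, (forall i, i \in s -> (g * i)%g \notin s') /\
    {ae m, forall w, S (D g w) <-> S w}) ->
  fcyls C -> measurable A -> decorr nu mu \1_S C A = 0.
Proof.
move=> mS hS [s [B [us mB ->]]] mA.
apply/normr0_eq0/eqP; rewrite eq_le normr_ge0 andbT.
apply/ler_addgt0Pr => e e0; rewrite add0r.
have [s' hs'] := (asymp_indep_indic hnu mu mS).2 e e0.
have [g [gs inv]] := hS s s'.
have mA' : measurable (b g^-1 @^-1` A).
  by rewrite -[X in measurable X]setTI; exact: (bpres _).1.
have us2 : uniq [seq (g * i)%g | i <- s] by rewrite map_inj_uniq//; exact: mulgI.
have := hs' _ (fun i => B (g^-1 * i)%g) _ us2 _ (fun=> mB _) mA'.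
have := bernoulli_shift_fcyl g^-1 s B; rewrite invgK => <-.
have -> : decorr nu mu \1_S (@bernoulli_shift G _ T g^-1 @^-1` fcyl s B) (b g^-1 @^-1` A)
    = decorr nu mu \1_S (fcyl s B) A.
  rewrite /decorr; have mC := measurable_fcyl s mB.
  have bC : bmfun (fun w : Y * X => \1_(fcyl s B) w.1 : R).
    by apply: bmfun_comp (bmfun_indic R mC); exact: measurable_fst.
  have bA : bmfun (fun w : Y * X => \1_A w.2 : R).
    by apply: bmfun_comp (bmfun_indic R mA); exact: measurable_snd.
  congr (_ - _ * _).
  - by rewrite (int_invariant mS inv (bmfunM bC bA)).
  - by rewrite (bernoulli_shift_preserving g^-1).2.
  - by rewrite (int_invariant mS inv bA).
by apply=> _ /mapP[i is_ ->]; exact: gs.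
Qed.

(** Let a be the conditional expectation of 1_S given the X-coordinate. Vanishing decorrelation says
    that 1_S and a have equal integrals over cylinders times sets of X, so they agree almost
    everywhere, and A is the set where a = 1. *)
Lemma invariant_set S : measurable S ->
  (forall s s' : seq G, exists g, (forall i, i \in s -> (g * i)%g \notin s') /\
    {ae m, forall w, S (D g w) <-> S w}) ->
  exists2 A : set X, measurable A & {ae m, forall w, S w <-> A w.2}.
Proof.
move=> mS hS.
have msnd := measure_preserving_snd nu mu.
have bS := bmfun_indic R mS.
have [a [ba aE]] := cond_exp msnd bS.
have ba2 : bmfun (fun w : Y * X => a w.2) by apply: bmfun_comp ba; exact: measurable_snd.
have : {ae m, forall w, \1_S w = a w.2}.
  apply: bmfun_ae_eq => // E mE.
  have bl := @bfunctional_int R _ _ _ (Y * X)%type m id _ (@measurable_id _ _ _) bS.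
  have bl' := @bfunctional_int R _ _ _ (Y * X)%type m id _ (@measurable_id _ _ _) ba2.
  have bL := bclosed_eq_bfunctional bl bl'.
  have [] : [set f : Y * X -> R | bmfun f /\ \int[m]_w (f w * \1_S w) =
      \int[m]_w (f w * a w.2)] \1_E; last by [].
  apply: (bclosed_setX (@measurable_fcyls G _ T) (@fcylsI G _ T) (@fcylsT G _ T) bL) => //.
  move=> C A CC mA.
  have mC : measurable C by rewrite measurable_fcyls; exact: sub_gen_smallest.
  have bC : bmfun (fun w : Y * X => \1_C w.1 : R).
    by apply: bmfun_comp (bmfun_indic R mC); exact: measurable_fst.
  have bA : bmfun (fun w : Y * X => \1_A w.2 : R).
    by apply: bmfun_comp (bmfun_indic R mA); exact: measurable_snd.
  split; first exact: bmfunM.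
  have := invariant_decorr mS hS CC mA; rewrite /decorr => /eqP.
  rewrite subr_eq0 => /eqP h.
  under eq_Rintegral do rewrite mulrC.
  rewrite h; under eq_Rintegral do rewrite mulrC.
  rewrite (aE _ (bmfun_indic R mA)).
  under [in RHS]eq_Rintegral do rewrite -mulrA.
  rewrite (Rintegral_prod nu mu (bmfun_indic R mC) (bmfunM (bmfun_indic R mA) ba)).
  by rewrite Rintegral_indic.
exists [set x | a x = 1].
  have := measurable_fun_eqr ba.1 (measurable_cst (1 : R)).
  have m1 : measurable [set true] by [].
  move=> /(_ measurableT _ m1); rewrite setTI.
  by congr measurable; apply/seteqP; split => x /=; [move/eqP|move=> ->; rewrite eqxx].
move: H; apply: filterS => w /= <-; rewrite indicE.
split; first by move=> Sw; rewrite mem_set.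
by case: (boolP (w \in S)); rewrite ?inE// => _ /eqP; rewrite eq_sym oner_eq0.
Qed.

End bernoulli.

(** * Standard Borel spaces *)

Lemma exists_half_expn_lt (R : realType) (e : R) : 0 < e -> exists n, 2^-1 ^+ n < e.
Proof.
move=> e0; have [n _ /(_ n (leqnn n))] := near_infty_natSinv_expn_lt (PosNum e0).
by rewrite /= div1r -exprVn => h; exists n.
Qed.

Lemma half_expn_le (R : realType) m n : (2^-1 ^+ m <= 2^-1 ^+ n :> R) = (n <= m)%N.
Proof. by rewrite ler_iXn2l// ?invr_gt0// invf_lt1// ltr1n. Qed.

(** The alias carries a metric of its own, and [R] records the field in which the distance takes its
    values. *)
Definition countable_cantor (R : realType) (I : countType) : Type := I -> bool.

Section cantor_metric.
Variables (R : realType) (I : countType).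
Local Notation P := (countable_cantor R I).
Implicit Types x y z : P.

HB.instance Definition _ := Choice.copy P (I -> bool).

Definition agree n x y := forall i, (pickle i < n)%N -> x i = y i.

Definition differ_at x y : pred nat := fun n => `[< exists2 i, pickle i = n & x i <> y i >].

Lemma differ_ex x y : x <> y -> exists n, differ_at x y n.
Proof.
move=> xy; apply: contra_notP xy => h; apply/funext => i.
apply: contra_notP h => xyi; exists (pickle i); apply/asboolP; by exists i.
Qed.

Definition cdist x y : R :=
  match pselect (x = y) with
  | left _ => 0
  | right xy => 2^-1 ^+ ex_minn (differ_ex xy)
  end.

(** Agreement on the coordinates coded below n is transitive, whence the distance is even an
    ultrametric; completeness and density are read off from agreement as well. *)
Lemma cdist_le n x y : cdist x y <= 2^-1 ^+ n <-> agree n x y.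
Proof.
rewrite /cdist; case: pselect => [->|xy].
  by split => // _; rewrite exprn_ge0// invr_ge0.
case: ex_minnP => k /asboolP[i ik xyi] kmin; rewrite half_expn_le; split.
  move=> nk j jn; apply: contrapT => xyj.
  have := kmin (pickle j); rewrite leqNgt (leq_trans jn nk) => /(_ _)/negP.
  by case=> //; apply/asboolP; exists j.
by move=> h; rewrite leqNgt; apply/negP => kn; apply: xyi; apply: h; rewrite ik.
Qed.

Lemma cdistxx x : cdist x x = 0.
Proof. by rewrite /cdist; case: pselect. Qed.

Lemma cdist_eq0 x y : cdist x y = 0 -> x = y.
Proof.
rewrite /cdist; case: pselect => // xy /eqP.
by rewrite expf_eq0 invr_eq0 pnatr_eq0 andbF.
Qed.

Lemma cdistC x y : cdist x y = cdist y x.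
Proof.
have H u v : cdist u v <= cdist v u.
  rewrite {2}/cdist; case: pselect => [->|vu]; first by rewrite cdistxx.
  apply/cdist_le => i ip.
  have := (cdist_le (ex_minn (differ_ex vu)) v u).1; rewrite /cdist.
  by case: pselect => // vu'; rewrite (Prop_irrelevance vu' vu) => /(_ (lexx _) i ip).
by apply/eqP; rewrite eq_le !H.
Qed.

Lemma cdist_triangle y x z : cdist x z <= cdist x y + cdist y z.
Proof.
have [->|xy] := pselect (x = y); first by rewrite cdistxx add0r.
have [->|yz] := pselect (y = z); first by rewrite cdistxx addr0.
have [a xya] : exists a, cdist x y = 2^-1 ^+ a.
  by rewrite /cdist; case: pselect => // h; eexists.
have [b yzb] : exists b, cdist y z = 2^-1 ^+ b.
  by rewrite /cdist; case: pselect => // h; eexists.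
have ha : agree a x y by apply/cdist_le; rewrite xya.
have hb : agree b y z by apply/cdist_le; rewrite yzb.
have h : cdist x z <= 2^-1 ^+ minn a b.
  by apply/cdist_le => i; rewrite ltn_min => /andP[/ha -> /hb].
rewrite (le_trans h)// xya yzb.
by rewrite /minn; case: ifP => _; rewrite ?lerDl ?lerDr exprn_ge0// invr_ge0.
Qed.

HB.instance Definition _ := isMetric.Build R P cdistxx cdist_eq0 cdistC cdist_triangle.

Lemma cball x (e : R) : ball x e = [set y | cdist x y < e].
Proof. by []. Qed.

Lemma cball_agree n x y : ball x (2^-1 ^+ n : R) y -> agree n x y.
Proof. by rewrite cball => /ltW/cdist_le. Qed.

Lemma agree_cball n x y (e : R) : 2^-1 ^+ n < e -> agree n x y -> ball x e y.
Proof. by move=> ne /cdist_le h; rewrite cball/=; exact: le_lt_trans h ne. Qed.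

Lemma cantor_polish : polish (countable_cantor R I : metricType R).
Proof.
split.
  move=> F FF /cauchyP Fc.
  have p0 n : 0 < 2^-1 ^+ n :> R by rewrite exprn_gt0// invr_gt0.
  have /choice[u hu] : forall n, exists x, F (ball x (2^-1 ^+ n : R)).
    by move=> n; have [x Fx] := Fc _ (p0 n); exists x.
  (* A ball of radius 2^-(n + 1) fixes the coordinate coded by n, so coordinate i of the limit is
     read at level [pickle i] plus one. *)
  pose l : P := fun i => u (pickle i).+1 i.
  have ul n : agree n (u n) l.
    move=> i ni; have [y [yn yi]] := filter_ex (filterI (hu n) (hu (pickle i).+1)).
    by rewrite (cball_agree yn ni) /l (cball_agree yi (ltnSn _)).
  exists l; apply/cvg_ballP => e e0; have [n ne] := exists_half_expn_lt e0.
  apply: filterS (hu n) => y yn; apply: agree_cball ne _ => i ni.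
  by rewrite -(cball_agree yn ni) (ul n).
exists (range (fun (s : seq I) => (fun i => i \in s) : P)).
  by apply: sub_countable (countableP [set: seq I]); exact: card_image_le.
move=> O [x Ox] oO; have := oO x Ox => /nbhs_ballP[e e0 xe].
have [n ne] := exists_half_expn_lt e0.
(* The dense set consists of the finitely supported sequences; this one copies x on the codes below
   n. *)
pose s := [seq i <- pmap pickle_inv (iota 0 n) | x i].
exists (fun i => i \in s); split; last by exists s.
apply: xe; apply: agree_cball ne _ => i ni.
rewrite mem_filter mem_pmap; have -> : Some i \in [seq pickle_inv k | k <- iota 0 n].
  by apply/mapP; exists (pickle i); rewrite ?mem_iota// pickleK_inv.
by rewrite andbT.
Qed.

(** Every open set is a countable union of the sets [U k], which prescribe finitely many coordinates
    according to a finitely supported sequence; they are cylinders, so the two sigma-algebras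
    coincide. *)
Lemma standard_borel_bool_power : standard_borel R (power_space I bool).
Proof.
exists (countable_cantor R I : metricType R), id; split; first exact: cantor_polish.
  by exists id.
move=> A; rewrite image_id; split.
  apply: smallest_sub; first exact: smallest_sigma_algebra.
  move=> _ [i [B mB ->]]; apply: sub_gen_smallest.
  rewrite openE => y By; apply/nbhs_ballP; exists (2^-1 ^+ (pickle i).+1).
    by rewrite /= exprn_gt0// invr_gt0.
  by move=> z /cball_agree yz /=; rewrite -yz.
apply: smallest_sub; first exact: sigma_algebra_measurable.
move=> O oO.
pose U (k : seq I * nat) : set P := [set y | agree k.2 y (fun i => i \in k.1)].
have mU k : measurable (U k : set (power_space I bool)).
  have -> : U k = fcyl (pmap pickle_inv (iota 0 k.2)) (fun i => [set i \in k.1]).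
    apply/seteqP; split => y h i.
      rewrite mem_pmap => /mapP[m]; rewrite mem_iota add0n /= => mk im.
      apply: h; have := @pickle_invK I m; rewrite -im /= => ->; exact: mk.
    move=> ni; apply: h; rewrite mem_pmap; apply/mapP.
    by exists (pickle i); rewrite ?mem_iota// pickleK_inv.
  exact: measurable_fcyl.
have -> : O = \bigcup_(k : seq I * nat) (if `[< U k `<=` O >] then U k else set0).
  apply/seteqP; split; last by move=> y [k _]; case: asboolP => // h; exact: h.
  move=> x Ox; have := oO x Ox => /nbhs_ballP[e e0 xe].
  have [n ne] := exists_half_expn_lt e0.
  pose s := [seq i <- pmap pickle_inv (iota 0 n) | x i].
  have xs : agree n x (fun i => i \in s).
    move=> i ni; rewrite mem_filter mem_pmap.
    have -> : Some i \in [seq pickle_inv k | k <- iota 0 n].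
      by apply/mapP; exists (pickle i); rewrite ?mem_iota// pickleK_inv.
    by rewrite andbT.
  exists (s, n) => //; case: asboolP => [//|]; case=> y /= ys.
  apply: xe; apply: agree_cball ne _ => i ni.
  by rewrite (ys i ni) (xs i ni).
apply: countable_bigcupT_measurable; first exact: countableP.
by move=> k; case: ifP.
Qed.

End cantor_metric.

(** It makes the set where two measurable maps agree measurable, as is needed to bring an almost
    everywhere identity down to a factor. *)
Definition countably_separated d (T : measurableType d) :=
  exists U : nat -> set T, (forall n, measurable (U n)) /\
    forall x y, (forall n, U n x <-> U n y) -> x = y.

Lemma countably_separated_index d (T : measurableType d) (I : countType)
    (U : I -> set T) : (forall i, measurable (U i)) ->
  (forall x y, (forall i, U i x <-> U i y) -> x = y) -> countably_separated T.
Proof.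
move=> mU sU; exists (fun n => if unpickle n is Some i then U i else set0); split.
  by move=> n; case: (unpickle n).
by move=> x y h; apply: sU => i; have := h (pickle i); rewrite pickleK.
Qed.

Lemma measurable_eq_fun d (T : measurableType d) d' (U : measurableType d')
    (f g : T -> U) : countably_separated U ->
  measurable_fun setT f -> measurable_fun setT g -> measurable [set x | f x = g x].
Proof.
move=> [V [mV sV]] mf mg.
have -> : [set x | f x = g x] = \bigcap_n
    ((f @^-1` V n `&` g @^-1` V n) `|` (f @^-1` (~` V n) `&` g @^-1` (~` V n))).
  apply/seteqP; split => x /=.
    by move=> fg n _ /=; rewrite fg; have [?|?] := pselect (V n (g x)); [left|right].
  by move=> h; apply: sV => n; case: (h n I) => -[].
apply: bigcapT_measurable => n.
have mp (h : T -> U) B : measurable_fun setT h -> measurable B -> measurable (h @^-1` B).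
  by move=> mh mB; rewrite -[X in measurable X]setTI; exact: mh.
have mC := measurableC (mV n).
by apply: measurableU; apply: measurableI; exact: mp.
Qed.

Lemma measurable_iff d (T : measurableType d) (A B : set T) :
  measurable A -> measurable B -> measurable [set x | A x <-> B x].
Proof.
move=> mA mB.
have -> : [set x | A x <-> B x] = (A `&` B) `|` (~` A `&` ~` B).
  apply/seteqP; split => x /=; last by case=> -[].
  by move=> AB; have [?|?] := pselect (A x); [left|right]; rewrite -AB.
by apply: measurableU; apply: measurableI => //; exact: measurableC.
Qed.

Lemma countably_separated_prod d (T : measurableType d) d' (U : measurableType d') :
  countably_separated T -> countably_separated U -> countably_separated (T * U)%type.
Proof.
move=> [V [mV sV]] [W [mW sW]].
apply: (@countably_separated_index _ _ (nat + nat)%type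
  (fun k => match k with inl n => fst @^-1` V n | inr n => snd @^-1` W n end)).
  by move=> [n|n]; rewrite -[X in measurable X]setTI;
    [exact: measurable_fst|exact: measurable_snd].
move=> [x1 x2] [y1 y2] h; congr pair.
  by apply: sV => n; exact: (h (inl n)).
by apply: sW => n; exact: (h (inr n)).
Qed.

Lemma countably_separated_power (I : countType) d (T : measurableType d) :
  countably_separated T -> countably_separated (power_space I T).
Proof.
move=> [V [mV sV]].
apply: (@countably_separated_index _ _ (I * nat)%type
  (fun k => (fun y : power_space I T => y k.1) @^-1` V k.2)).
  by move=> [i n]; rewrite -[X in measurable X]setTI; exact: measurable_coord.
move=> x y h; apply/funext => i; apply: sV => n; exact: (h (i, n)).
Qed.

Lemma countably_separated_bool : countably_separated bool.
Proof.
exists (fun=> [set true]); split => // -[] [] //= /(_ 0%N)[].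
  by move=> /(_ erefl).
by move=> _ /(_ erefl).
Qed.

Lemma countably_separated_circle (R : realType) : countably_separated (circle R).
Proof.
apply: (@countably_separated_index _ _ rat
  (fun r => @circle_rep R @^-1` [set x | ratr r < x])).
  move=> r; rewrite -[X in measurable X]setTI; apply: measurable_circle_rep => //.
  have -> : [set x : R | ratr r < x] = `]ratr r, +oo[%classic.
    by apply/seteqP; split => x /=; rewrite in_itv/= andbT.
  exact: measurable_itv.
move=> x y h; rewrite -[x]circle_repK -[y]circle_repK; congr circle_pi.
apply/eqP; rewrite eq_le; apply/andP; split; rewrite leNgt; apply/negP.
  move=> /rat_in_itvoo[r]; rewrite in_itv/= => /andP[r1 r2].
  by have := (h r).1 r2; rewrite /= ltNge ltW.
move=> /rat_in_itvoo[r]; rewrite in_itv/= => /andP[r1 r2].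
by have := (h r).2 r2; rewrite /= ltNge ltW.
Qed.

(** * Decoding a point of a Polish space from the balls containing it *)

Section standard_borel.
Context (R : realType) d (Q : measurableType d) (P : metricType R) (j : Q -> P).
Hypotheses (pP : polish P) (bj : bijective j).
Hypothesis jE : forall A : set Q, measurable A <-> <<s @open P >> (j @` A).

Let eps n : R := 2^-1 ^+ n.
Let eps0 n : 0 < eps n. Proof. by rewrite exprn_gt0// invr_gt0. Qed.
Let epsS n : eps n.+1 = eps n / 2. Proof. by rewrite /eps exprS mulrC. Qed.

Lemma measurable_preimage_open (O : set P) : open O -> measurable (j @^-1` O).
Proof.
move=> oO; apply/jE; rewrite image_preimage; first exact: sub_gen_smallest.
by case: bj => k kj jk; apply/seteqP; split => // x _; exists (k x).
Qed.

Lemma dense_seq : exists e : nat -> P, forall (x : P) (r : R), 0 < r ->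
  exists i, mdist (e i) x < r.
Proof.
have [_ [D /countable_injP[f finj] Dd]] := pP.
exists (fun n => xget (j point) [set x | D x /\ f x = n]) => x r r0.
have oB : open ((ball x r)°) by exact: open_interior.
have xB : (ball x r)° x by rewrite /interior; apply/nbhs_ballP; exists r.
have [y [yB Dy]] := Dd _ (ex_intro _ x xB) oB.
exists (f y); have [z [Dz fz] zE] : exists2 z, D z /\ f z = f y &
    xget (j point) [set x | D x /\ f x = f y] = z.
  exists (xget (j point) [set x | D x /\ f x = f y]) => //.
  by apply: (@xgetPex _ (j point) [set x | D x /\ f x = f y]); exists y.
rewrite zE; have <- : y = z by apply: finj; rewrite ?inE.
have := interior_subset yB; rewrite ballEmdist/= metric_sym; exact.
Qed.

Let e := sval (cid dense_seq).
Let eP : forall (x : P) (r : R), 0 < r -> exists i, mdist (e i) x < r.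
Proof. exact: svalP (cid dense_seq). Qed.

Let O i n : set P := (ball (e i) (eps n))°.

Let OP i n x : O i n x -> mdist (e i) x < eps n.
Proof. by move=> /interior_subset; rewrite ballEmdist. Qed.

Let Oex n x : exists i, O i n x.
Proof.
have [i hi] := eP x (divr_gt0 (eps0 n) (ltr0n R 2)); exists i.
apply/nbhs_ballP; exists (eps n / 2); first by rewrite /= divr_gt0.
move=> y; rewrite !ballEmdist/= => xy.
by rewrite (le_lt_trans (metric_triangle _ x _))// [ltRHS]splitr ltrD.
Qed.

Lemma countably_separated_standard : countably_separated Q.
Proof.
apply: (@countably_separated_index _ _ (nat * nat)%type (fun k => j @^-1` O k.1 k.2)).
  by move=> k; apply: measurable_preimage_open; exact: open_interior.
move=> x y h; apply: (bij_inj bj); apply: mdist_positivity.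
apply/eqP; rewrite eq_le mdist_ge0 andbT; apply/ler_addgt0Pr => r r0; rewrite add0r.
have [n nr] := exists_half_expn_lt (divr_gt0 r0 (ltr0n R 2)).
have [i xi] := Oex n (j x); have yi := (h (i, n)).1 xi.
have h1 := OP xi; have h2 := OP yi.
rewrite (le_trans (metric_triangle _ (e i) _))// metric_sym.
move: nr; rewrite -/(eps n) => nr; apply: ltW.
by rewrite (lt_trans (ltrD h1 h2))// [ltRHS]splitr ltrD.
Qed.

Context d' (W : measurableType d') (E : nat -> nat -> set W).
Hypothesis mE : forall i n, measurable (E i n).

(** [E i n] stands for the ball of radius 2^-n about [e i]. Taking the least index makes the
    selection measurable; the default 0 keeps it total. *)
Let N n w : nat := xget 0%N [set i | E i n w /\ forall k, (k < i)%N -> ~ E k n w].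

Let NP n w : (exists i, E i n w) -> E (N n w) n w.
Proof.
move=> [i Ei].
have ex : exists i, `[< E i n w >] by exists i; apply/asboolP.
have : exists i, E i n w /\ forall k, (k < i)%N -> ~ E k n w.
  case: (ex_minnP ex) => l /asboolP El lmin; exists l; split => // k kl Ek.
  by have := lmin k; rewrite leqNgt kl => /(_ (asboolT Ek)).
by move=> /(@xgetPex _ 0%N [set i | E i n w /\ forall k, (k < i)%N -> ~ E k n w])[].
Qed.

Let mN n (S : set nat) : measurable (N n @^-1` S).
Proof.
pose A i := E i n `\` \bigcup_(k in [set k | (k < i)%N]) E k n.
have mA i : measurable (A i).
  by apply: measurableD => //; apply: bigcup_measurable.
have A1 i w : A i w -> N n w = i.
  move=> [Ei nE]; have : exists i, E i n w /\ forall k, (k < i)%N -> ~ E k n w.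
    by exists i; split => // k ki Ek; apply: nE; exists k.
  move=> /(@xgetPex _ 0%N [set i | E i n w /\ forall k, (k < i)%N -> ~ E k n w]).
  rewrite -/(N n w) => -[EN NN]; apply/eqP; rewrite eqn_leq; apply/andP; split.
    by rewrite leqNgt; apply/negP => /NN.
  by rewrite leqNgt; apply/negP => Ni; apply: nE; exists (N n w).
have A2 w : ~ (exists i, E i n w) -> N n w = 0%N.
  move=> nE; rewrite /N; case: xgetP => //= i _ [Ei _].
  by exfalso; apply: nE; exists i.
have -> : N n @^-1` S = (\bigcup_(i in S) A i) `|`
    (if `[< S 0%N >] then ~` (\bigcup_i E i n) else set0).
  apply/seteqP; split => w.
    move=> SN; have [ex|nex] := pselect (exists i, E i n w).
      left; exists (N n w) => //; split; first exact: NP.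
      move=> [k /= kN Ek].
      have exk : exists i, `[< E i n w >] by exists k; apply/asboolP.
      have : exists i, E i n w /\ forall k, (k < i)%N -> ~ E k n w.
        case: (ex_minnP exk) => l /asboolP El lmin; exists l; split => // k' kl Ek'.
        by have := lmin k'; rewrite leqNgt kl => /(_ (asboolT Ek')).
      move=> /(@xgetPex _ 0%N [set i | E i n w /\ forall k, (k < i)%N -> ~ E k n w])[_].
      by move=> /(_ k kN).
    right; move: SN; rewrite /preimage/= (A2 _ nex) => S0.
    by rewrite asboolT// => -[i _ Ei]; apply: nex; exists i.
  case=> [[i Si /A1]|]; first by rewrite /preimage/= => ->.
  case: asboolP => // S0 nE; rewrite /preimage/= A2//.
  by move=> [i Ei]; apply: nE; exists i.
apply: measurableU.
  by apply: bigcup_measurable.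
case: ifP => // _; apply: measurableC; exact: bigcupT_measurable.
Qed.

Let hn n w : P := e (N n w).

(** Centres within eps n and eps n.+1 of a common point satisfy this inequality, so every genuine
    code lies in [W0]; conversely it makes the centres a Cauchy sequence. *)
Let W0 : set W := \bigcap_n [set w | mdist (hn n w) (hn n.+1 w) < 2 * eps n].

Let mW0 : measurable W0.
Proof.
apply: bigcapT_measurable => n.
have -> : [set w | mdist (hn n w) (hn n.+1 w) < 2 * eps n] =
    \bigcup_(k : nat * nat) (if mdist (e k.1) (e k.2) < 2 * eps n
      then N n @^-1` [set k.1] `&` N n.+1 @^-1` [set k.2] else set0).
  apply/seteqP; split => w /=.
    by move=> h; exists (N n w, N n.+1 w) => //=; rewrite h.
  by move=> [[a b] _] /=; case: ifP => // h [/= na nb]; rewrite /hn na nb.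
apply: countable_bigcupT_measurable; first exact: countableP.
by move=> k; case: ifP => // _; apply: measurableI.
Qed.

(** The limit of the centres, described by explicit inequalities: 4 eps n is the sum of the tail 2
    eps n + 2 eps (n + 1) + ... *)
Let near_lim w : set P := [set x | forall n, mdist (hn n w) x <= 4 * eps n].

Let near_lim_ex w : W0 w -> exists x, near_lim w x.
Proof.
move=> Ww.
have step n k : mdist (hn n w) (hn (n + k) w) <= 4 * eps n - 4 * eps (n + k).
  elim: k => [|k ih]; first by rewrite addn0 mdistxx subrr.
  have := Ww (n + k)%N I; rewrite /= => hk.
  rewrite addnS (le_trans (metric_triangle _ (hn (n + k) w) _))//.
  have := epsS (n + k); lra.
have dist n k : mdist (hn n w) (hn (n + k) w) <= 4 * eps n.
  by rewrite (le_trans (step n k))// gerBl mulr_ge0// ltW.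
have cF : cauchy (hn ^~ w @ \oo).
  apply/cauchyP => r r0; have [n nr] := exists_half_expn_lt (divr_gt0 r0 (ltr0n R 5)).
  exists (hn n w); exists n => // k /= nk; rewrite ballEmdist/=.
  have := dist n (k - n)%N; rewrite subnKC// => /le_lt_trans; apply.
  by move: nr; rewrite -/(eps n) => nr; have := eps0 n; lra.
have [x xl] := pP.1 _ _ cF.
exists x => n; apply/ler_addgt0Pr => r r0.
have := xl => /cvg_ballP/(_ _ r0)[K _ /(_ (n + K)%N (leq_addl _ _))].
rewrite ballEmdist/= metric_sym => hK.
by rewrite (le_trans (metric_triangle _ (hn (n + K) w) _))// lerD// ltW.
Qed.

Let near_lim_uniq w x y : near_lim w x -> near_lim w y -> x = y.
Proof.
move=> hx hy; apply: mdist_positivity.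
apply/eqP; rewrite eq_le mdist_ge0 andbT; apply/ler_addgt0Pr => r r0; rewrite add0r.
have [n nr] := exists_half_expn_lt (divr_gt0 r0 (ltr0n R 8)).
rewrite (le_trans (metric_triangle _ (hn n w) _))//.
rewrite [mdist x _]metric_sym; have := hx n; have := hy n.
by move: nr; rewrite -/(eps n); lra.
Qed.

Let H w : P := if `[< W0 w >] then xget (j point) (near_lim w) else j point.

Let HP w : W0 w -> near_lim w (H w).
Proof.
by move=> Ww; rewrite /H asboolT//; apply: xgetPex; exact: near_lim_ex.
Qed.

Let mH_open (B : set P) : open B -> measurable (H @^-1` B).
Proof.
move=> oB.
(* The limit is within 4 eps n of the centre, so a good code at one level places it in B.
   Conversely, if the ball of radius r about the limit lies in B, the code is good as soon as 12 eps
   n < r, since 12 = 4 + 8. *)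
pose good n : set nat := [set i | forall y, mdist (e i) y < 8 * eps n -> B y].
have -> : H @^-1` B = (W0 `&` \bigcup_n (N n @^-1` good n)) `|`
    (if `[< B (j point) >] then ~` W0 else set0).
  apply/seteqP; split => w /=.
    move=> BH; have [Ww|Ww] := pselect (W0 w); last first.
      by right; move: BH; rewrite /H asboolF// => Bj; rewrite asboolT.
    left; split => //; have := oB; rewrite openE => /(_ _ BH)/nbhs_ballP[r r0 rB].
    have [n nr] := exists_half_expn_lt (divr_gt0 r0 (ltr0n R 12)).
    exists n => // y yn; apply: rB; rewrite ballEmdist/=.
    rewrite (le_lt_trans (metric_triangle _ (hn n w) _))// metric_sym.
    have := HP Ww n; move: yn nr; rewrite -/(eps n) /hn; lra.
  case=> [[Ww [n _ gn]]|].
    apply: gn; have := HP Ww n; rewrite /hn => /le_lt_trans; apply.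
    by have := eps0 n; lra.
  by case: asboolP => // Bj nW; rewrite /H asboolF.
apply: measurableU.
  by apply: measurableI => //; apply: bigcupT_measurable => n; exact: mN.
by case: ifP => // _; exact: measurableC.
Qed.

(** A code w of q selects at each level a centre within eps n of j q, so the limit is j q. The sets
    E need not come from points of Q at other w, where the value is the limit or a fixed default. *)
Lemma standard_borel_section : exists h : W -> Q, measurable_fun setT h /\
  forall w q, (forall i n, E i n w <-> (ball (e i) (eps n))° (j q)) -> h w = q.
Proof.
have [k jk kj] := bj.
exists (k \o H); split.
  move=> _ A mA; rewrite setTI.
  have -> : (k \o H) @^-1` A = H @^-1` (j @` A).
    apply/seteqP; split => w /=; first by move=> h; exists (k (H w)).
    by move=> [q Aq <-]; rewrite jk.
  have : <<s @open P >> (j @` A) by apply/jE.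
  pose C := [set B : set P | measurable (H @^-1` B)].
  suff : <<s @open P >> `<=` C by move=> h /h.
  apply: smallest_sub; last by move=> B oB; exact: mH_open.
  split.
  - by rewrite /C/= preimage_set0.
  - move=> B mB; rewrite /C/= setTD preimage_setC; exact: measurableC.
  - by move=> B mB; rewrite /C/= preimage_bigcup; exact: bigcupT_measurable.
move=> w q hq /=; rewrite -[RHS]jk; congr k.
have Nn n : mdist (hn n w) (j q) < eps n.
  have [i iq] := Oex n (j q); apply: OP; apply/hq; apply: NP.
  by exists i; apply/hq.
have Ww : W0 w.
  move=> n _ /=; rewrite (le_lt_trans (metric_triangle _ (j q) _))//.
  rewrite [mdist (j q) _]metric_sym; have := Nn n; have := Nn n.+1.
  by have := epsS n; have := eps0 n; lra.
apply: near_lim_uniq (HP Ww) _ => n; rewrite ltW// (lt_trans (Nn n))//.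
by have := eps0 n; lra.
Qed.

End standard_borel.

Lemma standard_borel_separated (R : realType) d (Q : measurableType d) :
  standard_borel R Q -> countably_separated Q.
Proof. by move=> [P [j [pP bj jE]]]; exact: (countably_separated_standard pP bj jE). Qed.

(** * Almost everywhere identities and measure-preserving maps *)

Lemma ae_forall_countable (R : realType) d (T : measurableType d)
    (m : probability T R) (I : countType) (P : I -> T -> Prop) :
  (forall i, {ae m, forall x, P i x}) -> {ae m, forall x, forall i, P i x}.
Proof.
move=> h.
have : {ae m, forall x n, (if unpickle n is Some i then P i x else True)}.
  apply: ae_foralln => n; case: (unpickle n) => [i|]; first exact: h.
  by apply: aeW.
by apply: filterS => x hx i; have := hx (pickle i); rewrite pickleK.
Qed.

Lemma ae_preserving (R : realType) d (T : measurableType d) d' (U : measurableType d')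
    (m : probability T R) (m' : probability U R) (p : T -> U) (P : U -> Prop) :
  measure_preserving m m' p -> {ae m', forall u, P u} -> {ae m, forall x, P (p x)}.
Proof.
move=> [mp pm] [A [mA A0 PA]]; exists (p @^-1` A); split.
- by rewrite -[X in measurable X]setTI; exact: mp.
- exact: etrans (pm _ mA) A0.
- by move=> x /= nP; apply: PA.
Qed.

(** Measurability of P matters: the exceptional null set upstairs need not be a preimage, so the
    null set downstairs must be the complement of P itself. *)
Lemma ae_preserving_inv (R : realType) d (T : measurableType d) d'
    (U : measurableType d') (m : probability T R) (m' : probability U R)
    (p : T -> U) (P : U -> Prop) :
  measure_preserving m m' p -> measurable [set u | P u] ->
  {ae m, forall x, P (p x)} -> {ae m', forall u, P u}.
Proof.
move=> [mp pm] mP h; exists (~` [set u | P u]); split => //.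
  exact: measurableC.
have mC := measurableC mP.
apply: etrans (esym (pm _ mC)) _; apply: measure_negligible => //.
by rewrite -[X in measurable X]setTI; exact: mp.
Qed.

(** Only the preimages of the countably many balls that code a point of Q are expressed through k,
    outside a single null set; the code is then read on W and decoded. *)
Lemma standard_borel_lift (R : realType) d (Q : measurableType d) d'
    (W : measurableType d') (eta : probability Q R) (k : Q -> W) :
  standard_borel R Q ->
  (forall D : set Q, measurable D -> exists2 E : set W, measurable E &
     {ae eta, forall u, D u <-> E (k u)}) ->
  exists2 h : W -> Q, measurable_fun setT h & {ae eta, forall u, h (k u) = u}.
Proof.
move=> [P [j [pP bj jE]]] hE.
pose e := sval (cid (dense_seq j pP)).
pose D i n := j @^-1` ((ball (e i) (2^-1 ^+ n : R))°).
have mD i n : measurable (D i n).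
  by apply: (measurable_preimage_open bj jE); exact: open_interior.
have /choice[E EP] : forall i : nat * nat, exists E : set W, measurable E /\
    {ae eta, forall u, D i.1 i.2 u <-> E (k u)}.
  by move=> [i n]; have [E mE DE] := hE _ (mD i n); exists E.
have [h [mh hP]] := standard_borel_section pP bj jE
  (fun i n => (EP (i, n)).1 : measurable ((fun i n => E (i, n)) i n)).
exists h => //.
have := ae_forall_countable (fun i => (EP i).2); apply: filterS => u hu.
by apply: hP => i n; have [h1 h2] := hu (i, n); split.
Qed.

Lemma probability_image (R : realType) d (T : measurableType d) d'
    (U : measurableType d') (m : probability T R) (f : T -> U) :
  measurable_fun setT f -> exists m' : probability U R, measure_preserving m m' f.
Proof.
move=> mf; pose fm : {mfun T >-> U} := HB.pack f (isMeasurableFun.Build _ _ _ _ f mf).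
by exists (distribution m fm).
Qed.

Lemma Rintegral_ae_eq (R : realType) d (T : measurableType d) (m : probability T R)
    (f g : T -> R) : bmfun f -> bmfun g -> {ae m, forall x, f x = g x} ->
  \int[m]_x f x = \int[m]_x g x.
Proof.
move=> [mf _] [mg _] fg; congr fine; apply: ae_eq_integral => //.
- exact/measurable_EFinP.
- exact/measurable_EFinP.
- by move: fg; apply: filterS => x -> .
Qed.

Lemma measure_preserving_ae (R : realType) d (T : measurableType d) d'
    (U : measurableType d') (m : probability T R) (m' : probability U R)
    (f g : T -> U) : measurable_fun setT g -> {ae m, forall x, f x = g x} ->
  measure_preserving m m' f -> measure_preserving m m' g.
Proof.
move=> mg fg pf; apply: measure_preservingP => // A mA.
have bA := bmfun_indic R mA.
rewrite -(Rintegral_preserving pf bA).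
apply: Rintegral_ae_eq; [exact: bmfun_comp|exact: bmfun_comp pf.1 bA|].
by move: fg; apply: filterS => x -> .
Qed.

Lemma measure_preserving_factor (R : realType) d (T : measurableType d) d'
    (U : measurableType d') d'' (V : measurableType d'') (m : probability T R)
    (m' : probability U R) (m'' : probability V R) (f : T -> U) (h : U -> V) :
  measure_preserving m m' f -> measurable_fun setT h ->
  measure_preserving m m'' (h \o f) -> measure_preserving m' m'' h.
Proof.
move=> pf mh phf; apply: measure_preservingP => // A mA.
have bA := bmfun_indic R mA.
by rewrite -(Rintegral_preserving phf bA) -(Rintegral_preserving pf (bmfun_comp mh bA)).
Qed.

Lemma measure_preserving_comp (R : realType) d (T : measurableType d) d'
    (U : measurableType d') d'' (V : measurableType d'') (m : probability T R)
    (m' : probability U R) (m'' : probability V R) (f : T -> U) (h : U -> V) :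
  measure_preserving m m' f -> measure_preserving m' m'' h ->
  measure_preserving m m'' (h \o f).
Proof.
move=> [mf pf] [mh ph]; split; first exact: measurableT_comp.
move=> B mB; rewrite comp_preimage pf ?ph//.
by rewrite -[X in measurable X]setTI; exact: mh.
Qed.

Lemma measure_preserving_id (R : realType) d (T : measurableType d)
    (m : probability T R) : measure_preserving m m id.
Proof. by split => // B mB; rewrite preimage_id. Qed.

(** * The intermediate factor *)

Lemma torus2_action_is_action (R : realType) : is_action (@torus2_action R).
Proof.
split=> [[x y]|g h [x y]].
  by rewrite /torus2_action !mxE /= !mulr1z !mulr0z addr0 add0r.
rewrite -[(g * h)%g]/(SL2Z_mul g h) /torus2_action /= !mxE.
rewrite !big_ord_recl !big_ord0 !addr0.
have e1 : lift ord0 ord0 = 1 :> 'I_2 by apply: val_inj.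
have e0 : ord0 = 0 :> 'I_2 by apply: val_inj.
rewrite !e1 e0; congr pair; rewrite !mulrzDl !mulrzDr -!mulrzA addrACA;
  by rewrite ![_ * g _ _]mulrC.
Qed.

(** * Stabilizers of characters *)

Section parabolic.
Variables (a b : int).

(* The transpose of 1 + n (a, b)^T (- b, a), since int2_action is the transposed
   action. *)
Definition parabolic_mx (n : nat) : 'M[int]_2 :=
  \matrix_(i, j) (if i == 0 then (if j == 0 then 1 - n%:Z * a * b else - n%:Z * b ^+ 2)
                  else (if j == 0 then n%:Z * a ^+ 2 else 1 + n%:Z * a * b)).

Lemma det2 (M : 'M[int]_2) : \det M = M 0 0 * M 1 1 - M 0 1 * M 1 0.
Proof.
rewrite (expand_det_row _ 0) !big_ord_recl big_ord0 addr0 /cofactor !det_mx11 !mxE.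
rewrite /= expr0 expr1 mul1r mulN1r mulrN.
by congr (_ * M _ _ - M _ _ * M _ _); apply: val_inj.
Qed.

Lemma parabolic_det n : \det (parabolic_mx n) == 1.
Proof. by rewrite det2 !mxE /=; apply/eqP; ring. Qed.

Definition parabolic n : SL2Z := MkSL2Z (parabolic_det n).

Lemma parabolic_fix n : int2_action (parabolic n) (a, b) = (a, b).
Proof. by rewrite /int2_action /= !mxE/=; congr pair; ring. Qed.

Lemma parabolic_inj : (a, b) != (0, 0) -> injective parabolic.
Proof.
move=> ab n m /(congr1 (fun g : SL2Z => (g 0 1, g 1 0))) /=.
rewrite !mxE /= => -[] h1 h2; apply/eqP; rewrite -eqz_nat; apply/eqP.
have [a0|a0] := eqVneq a 0.
  have b0 : b ^+ 2 != 0.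
    by rewrite expf_eq0 /=; apply: contra_neq ab => b0; rewrite a0 b0.
  by apply: (mulIf b0); move/eqP: h1; rewrite !mulNr eqr_opp => /eqP.
have a20 : a ^+ 2 != 0 by rewrite expf_eq0.
exact: (mulIf a20).
Qed.

End parabolic.

(** If k n i lies in s' for some i in s, then k n lies in the finite set of the products j i^-1,
    which an injective sequence must leave. *)
Lemma injective_escape (G : groupType) (k : nat -> G) : injective k ->
  forall s s' : seq G, exists n, forall i, i \in s -> (k n * i)%g \notin s'.
Proof.
move=> kinj s s'.
pose z := [seq (j * i^-1)%g | i <- s, j <- s'].
have [n kn] : exists n, k n \notin z.
  apply: contrapT => /forallNP h.
  have hz n : k n \in z by have := h n => /negP; rewrite negbK.
  have : (size [seq k n | n <- iota 0 (size z).+1] <= size z)%N.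
    apply: uniq_leq_size; first by rewrite map_inj_uniq ?iota_uniq.
    by move=> _ /mapP[n _ ->].
  by rewrite size_map size_iota ltnn.
exists n => i is_; apply/negP => kis; move/negP: kn; apply.
apply/allpairsP; exists (i, (k n * i)%g); split => //=.
by rewrite -mulgA mulgV mulg1.
Qed.

Lemma stabilizer_escape (v : int * int) (s s' : seq SL2Z) :
  exists g, (forall i, i \in s -> (g * i)%g \notin s') /\ int2_action g v = v.
Proof.
have [->|v0] := eqVneq v (0, 0).
  (* The zero vector is fixed by all of SL_2(Z), so any infinite family will do. *)
  have inj := @parabolic_inj 1 0 isT.
  have [n hn] := injective_escape inj s s'.
  by exists (parabolic 1 0 n); split => //; exact: int2_action0.
case: v v0 => a b v0; have [n hn] := injective_escape (parabolic_inj v0) s s'.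
by exists (parabolic a b n); split => //; exact: parabolic_fix.
Qed.

(** * Coding a bounded real number by its rational cuts *)

Section threshold.
Variables (R : realType) (M : R).

(* The infimum recovers x from {r : rat | x < r}; the cut-offs at - M - 1 and M + 1
   keep it an infimum of a bounded set for every z. *)
Definition threshold_seq (z : rat -> bool) (n : nat) : R :=
  if unpickle n is Some r then if z r then Num.max (- M - 1) (ratr r) else M + 1
  else M + 1.

Definition threshold (z : rat -> bool) : R := inf (range (threshold_seq z)).

Lemma threshold_seq_ge z n : 0 <= M -> - M - 1 <= threshold_seq z n.
Proof.
move=> M0; rewrite /threshold_seq; case: unpickle => [r|]; last lra.
by case: ifP => _; [rewrite le_max lexx|lra].
Qed.

Lemma threshold_has_lbound z : 0 <= M -> has_lbound (range (threshold_seq z)).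
Proof. by move=> M0; exists (- M - 1) => _ [n _ <-]; exact: threshold_seq_ge. Qed.

Lemma threshold_bound z : 0 <= M -> `|threshold z| <= M + 1.
Proof.
move=> M0; rewrite ler_norml; apply/andP; split.
  apply: lb_le_inf; first by exists (threshold_seq z 0%N); exists 0%N.
  move=> _ [n _ <-]; have := threshold_seq_ge z n M0; lra.
apply: (@le_trans _ _ (threshold_seq z (pickle (0 : rat)))).
  by apply: ge_inf; [exact: threshold_has_lbound|exists (pickle (0 : rat))].
rewrite /threshold_seq pickleK; case: ifP => // _.
by rewrite ge_max raddf0; apply/andP; split; lra.
Qed.

Lemma thresholdE (x : R) : `|x| <= M -> threshold (fun r => x < ratr r) = x.
Proof.
move=> xM; have M0 : 0 <= M by rewrite (le_trans _ xM).
have := xM; rewrite ler_norml => /andP[xM1 xM2].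
apply/eqP; rewrite eq_le; apply/andP; split.
  apply/ler_addgt0Pr => e e0.
  have /rat_in_itvoo[r] : x < x + e by rewrite ltrDl.
  rewrite in_itv/= => /andP[xr re]; apply: le_trans (ltW re).
  apply: (@le_trans _ _ (threshold_seq (fun r => x < ratr r) (pickle r))).
    by apply: ge_inf; [exact: threshold_has_lbound|exists (pickle r)].
  by rewrite /threshold_seq pickleK xr ge_max lexx andbT; lra.
apply: lb_le_inf.
  by exists (threshold_seq (fun r => x < ratr r) 0%N); exists 0%N.
move=> _ [n _ <-]; rewrite /threshold_seq; case: unpickle => [r|]; last lra.
by case: ifP => xr; [rewrite le_max (ltW xr) orbT|lra].
Qed.

Lemma measurable_threshold d (T : measurableType d) (z : T -> rat -> bool) : 0 <= M ->
  (forall r, measurable_fun setT (fun t => z t r)) ->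
  measurable_fun setT (fun t => threshold (z t)).
Proof.
move=> M0 mz.
have -> : (fun t => threshold (z t)) = (fun t => infs (threshold_seq (z t)) 0%N).
  apply/funext => t; rewrite /threshold /infs/=; congr inf.
  by apply/seteqP; split => x [n ? <-]; exists n.
apply: (@measurable_fun_infs _ _ _ setT (fun n t => threshold_seq (z t) n)).
  by move=> t _; exact: threshold_has_lbound.
move=> n; rewrite /threshold_seq; case: (unpickle n) => [r|]; last exact: measurable_cst.
by apply: measurable_fun_ifT.
Qed.

End threshold.

(** * Construction of Z and of the conjugacy *)

Section intermediate_factor.
Context (R : realType).
Local Notation Y := (power_space SL2Z (circle R)).
Local Notation X := (torus2 R).
Local Notation mu := (haar_torus2 R).
Local Notation shift := (@bernoulli_shift SL2Z _ (circle R)).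
Local Notation act := (@torus2_action R).
Context (nu : probability Y R) (hnu : is_power_measure (@haar_circle R) nu).
Local Notation m := (nu \x mu)%E.
Local Notation D := (diag_action shift act).
Context (d : measure_display) (Q : measurableType d) (stdQ : standard_borel R Q)
  (eta : probability Q R) (c : SL2Z -> Q -> Q) (hc : pmp_action eta c)
  (p : Y * X -> Q) (q : Q -> Y)
  (hp : factor_map m D eta c p) (hq : factor_map eta c nu shift q)
  (hqp : {ae m, forall w, q (p w) = w.1}).

Let Dp g : measure_preserving m m (D g).
Proof. exact: (diag_preserving hnu (@torus2_action_preserving R)). Qed.

Let btc v : bmfun (fun w : Y * X => tchar v w.2).
Proof. by apply: bmfun_comp (bmfun_tchar R v); exact: measurable_snd. Qed.

Let condE v : exists phi : Q -> R, bmfun phi /\ forall f, bmfun f ->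
  \int[m]_w (f (p w) * tchar v w.2) = \int[eta]_u (f u * phi u).
Proof. exact: cond_exp hp.1 _ (btc v). Qed.

Let phi v : Q -> R := sval (cid (condE v)).

Let bphi v : bmfun (phi v). Proof. by case: (svalP (cid (condE v))). Qed.

Let phiE v f : bmfun f ->
  \int[m]_w (f (p w) * tchar v w.2) = \int[eta]_u (f u * phi v u).
Proof. by case: (svalP (cid (condE v))) => _; apply. Qed.

Let cK g u : c g^-1%g (c g u) = u.
Proof. by rewrite -hc.1.2 mulVg hc.1.1. Qed.

(** Both sides are tested against 1_A on Q. The change of variable by g is made on Q and then on Y *
    X, where it carries the character v to its image under the dual action. *)
Lemma phi_equivariant g v : {ae eta, forall u, phi v (c g u) = phi (int2_action g v) u}.
Proof.
have pc := hc.2.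
apply: bmfun_ae_eq => [|//|A mA]; first exact: bmfun_comp (pc g).1 (bphi v).
have bA := bmfun_indic R mA; have bAc := bmfun_comp (pc g^-1%g).1 bA.
transitivity (\int[eta]_u (\1_A (c g^-1%g u) * phi v u)).
  rewrite -(Rintegral_preserving (pc g) (bmfunM bAc (bphi v))).
  by apply: eq_Rintegral => u _; rewrite cK.
rewrite -(phiE _ bAc) -(phiE _ bA).
have bApc := bmfun_comp hp.1.1 bAc.
rewrite -(Rintegral_preserving (Dp g) (bmfunM bApc (btc v))).
apply: Rintegral_ae_eq.
- exact: bmfun_comp (Dp g).1 (bmfunM bApc (btc v)).
- exact: bmfunM (bmfun_comp hp.1.1 bA) (btc _).
- by have := hp.2 g; apply: filterS => w ->; rewrite cK /diag_action/= tchar_action.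
Qed.

Let S v r : set (Y * X) := [set w | phi v (p w) < ratr r].

Let mphi_lt v r : measurable [set u | phi v u < ratr r].
Proof.
have := measurable_fun_ltr (bphi v).1 (measurable_cst (ratr r : R)).
have m1 : measurable [set true] by [].
by move=> /(_ measurableT _ m1); rewrite setTI.
Qed.

Let mS v r : measurable (S v r).
Proof.
rewrite -[S v r]setTI; exact: (hp.1.1 measurableT _ (mphi_lt v r)).
Qed.

Let phi_p g v : {ae m, forall w, phi v (p (D g w)) = phi (int2_action g v) (p w)}.
Proof.
have := ae_preserving hp.1 (phi_equivariant g v); have := hp.2 g.
by apply: filterS2 => w ->.
Qed.

(** Elements of the stabilizer of v leave [phi v] composed with p unchanged almost everywhere, and
    they can be chosen to separate any two finite sets of coordinates. *)
Let invS v r : exists2 A : set X, measurable A & {ae m, forall w, S v r w <-> A w.2}.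
Proof.
apply: (invariant_set hnu (torus2_action_is_action R) (@torus2_action_preserving R) (mS v r)).
move=> s s'; have [g [gs gv]] := stabilizer_escape v s s'.
exists g; split => //; have := phi_p g v; apply: filterS => w.
by rewrite gv /S/= => ->.
Qed.

Let A v r : set X := s2val (cid2 (invS v r)).
Let mA v r : measurable (A v r). Proof. exact: s2valP (cid2 (invS v r)). Qed.
Let SA v r : {ae m, forall w, S v r w <-> A v r w.2}.
Proof. exact: s2valP' (cid2 (invS v r)). Qed.

Local Notation I := ((int * int) * rat)%type.
Local Notation Z := (power_space I bool).

Let f (x : X) : Z := fun i => `[< A i.1 i.2 x >].

Let mf : measurable_fun setT f.
Proof.
apply: measurable_power_fun => i; apply: (measurable_fun_bool true).
rewrite setTI; have := mA i.1 i.2; congr measurable.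
by apply/seteqP; split => x /=; [move=> h; exact: asboolT|move/asboolP].
Qed.

(** A left action at every point: precomposition undoes the reversed order of [int2_action]. *)
Let b (g : SL2Z) (z : Z) : Z := fun i => z (int2_action g i.1, i.2).

Let bact : is_action b.
Proof.
split=> [z|g h z]; apply/funext => -[v r]; rewrite /b/=.
  by rewrite int2_action1.
by rewrite int2_actionM.
Qed.

Let mb g : measurable_fun setT (b g).
Proof. by apply: measurable_power_fun => i; exact: measurable_coord. Qed.

Let msnd : measure_preserving m mu snd := measure_preserving_snd nu mu.

Let sepZ : countably_separated Z.
Proof. exact: countably_separated_power countably_separated_bool. Qed.

Let sepYZ : countably_separated (Y * Z)%type.
Proof.
apply: countably_separated_prod sepZ.
exact: countably_separated_power (countably_separated_circle R).
Qed.

(** The sets A agree with level sets of [phi] only on Y * X and almost everywhere, so the identity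
    is checked there for all countably many indices at once and then brought down along the
    projection to X. *)
Lemma f_equivariant g : {ae mu, forall x, f (act g x) = b g (f x)}.
Proof.
have mact := (@torus2_action_preserving R g).1.
apply: (ae_preserving_inv msnd).
  exact: (measurable_eq_fun sepZ (measurableT_comp mf mact) (measurableT_comp (mb g) mf)).
have h1 : {ae m, forall w, forall i : I, S i.1 i.2 w <-> A i.1 i.2 w.2}.
  by apply: ae_forall_countable => i; exact: SA.
have h2 := ae_preserving (Dp g) h1.
have h3 : {ae m, forall w, forall v, phi v (p (D g w)) = phi (int2_action g v) (p w)}.
  by apply: ae_forall_countable => v; exact: phi_p.
move: h1 h2 h3; apply: filterS3 => w h1 h2 h3.
apply/funext => -[v r]; rewrite /f /b/=.
have k1 := h1 (int2_action g v, r); have k2 := h2 (v, r).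
by apply: asbool_equiv_eq; rewrite -k1 -k2 /S/= h3.
Qed.

Let pf : exists zeta : probability Z R, measure_preserving mu zeta f.
Proof. exact: probability_image. Qed.

Let zeta := sval (cid pf).
Let fzeta : measure_preserving mu zeta f. Proof. exact: svalP (cid pf). Qed.

Let pb g : measure_preserving zeta zeta (b g).
Proof.
apply: (measure_preserving_factor fzeta (mb g)).
have mbf : measurable_fun setT (b g \o f) := measurableT_comp (mb g) mf.
apply: (measure_preserving_ae mbf (f_equivariant g)).
exact: (measure_preserving_comp (@torus2_action_preserving R g) fzeta).
Qed.

Let zmap (u : Q) : Z := fun i => phi i.1 u < ratr i.2.

Let mzmap : measurable_fun setT zmap.
Proof.
apply: measurable_power_fun => i; apply: (measurable_fun_bool true).
by rewrite setTI; exact: mphi_lt.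
Qed.

(** The future conjugacy. The level sets of [phi] themselves, rather than the chosen sets A, give
    its Z-coordinate; on Y * X it becomes the identity times f, which identifies its image
    measure. *)
Let k (u : Q) : Y * Z := (q u, zmap u).

Let mk : measurable_fun setT k.
Proof. by apply: measurable_fun_pair => //; exact: hq.1.1. Qed.

Let kp : {ae m, forall w, (w.1, f w.2) = k (p w)}.
Proof.
have h1 : {ae m, forall w, forall i : I, S i.1 i.2 w <-> A i.1 i.2 w.2}.
  by apply: ae_forall_countable => i; exact: SA.
move: hqp h1; apply: filterS2 => w h1 h2; rewrite /k h1; congr pair.
apply/funext => i; rewrite /f /zmap.
by apply/asboolP/idP => [/h2|h]; [|apply/h2].
Qed.

Let pk : measure_preserving eta (nu \x zeta)%E k.
Proof.
apply: (measure_preserving_factor hp.1 mk).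
have mkp : measurable_fun setT (k \o p) := measurableT_comp mk hp.1.1.
apply: (measure_preserving_ae mkp kp).
exact: (measure_preserving_prod (measure_preserving_id nu) fzeta).
Qed.

Let k_equivariant g : {ae eta, forall u, k (c g u) = diag_action shift b g (k u)}.
Proof.
have h : {ae eta, forall u, forall v, phi v (c g u) = phi (int2_action g v) u}.
  by apply: ae_forall_countable => v; exact: phi_equivariant.
move: (hq.2 g) h; apply: filterS2 => u h1 h2.
rewrite /k /diag_action/= h1; congr pair; apply/funext => i.
by rewrite /zmap /b/= h2.
Qed.

(** Decoding the rational cuts recovers the value at every point of Q, so the conditional
    expectation of a character factors through the Z-coordinate of k. *)
Let phi_k v : exists a : Z -> R, bmfun a /\ forall u, phi v u = a (zmap u).
Proof.
have [_ [M phiM]] := bphi v.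
have M0 : 0 <= M by exact: le_trans (phiM point).
exists (fun z => threshold M (fun r => z (v, r))); split.
  split; last by exists (M + 1) => z; exact: threshold_bound.
  by apply: measurable_threshold => // r; exact: measurable_coord.
by move=> u; rewrite /zmap/= thresholdE.
Qed.

Lemma k_generates (B : set Q) : measurable B ->
  exists2 E : set (Y * Z), measurable E & {ae eta, forall u, B u <-> E (k u)}.
Proof.
move=> mB; have bB := bmfun_indic R mB.
have [del [bdel delE]] := cond_exp pk bB.
have bdelk : bmfun (fun u => del (k u)) := bmfun_comp mk bdel.
have bBp := bmfun_comp hp.1.1 bB; have bdelp := bmfun_comp hp.1.1 bdelk.
have tcharE v C : measurable C ->
    \int[m]_w (tchar v w.2 * (\1_C w.1 * \1_B (p w))) =
    \int[m]_w (tchar v w.2 * (\1_C w.1 * del (k (p w)))).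
  move=> mC; have bC := bmfun_indic R mC.
  have bC1 : bmfun (fun w : Y * X => \1_C w.1 : R).
    by apply: bmfun_comp bC; exact: measurable_fst.
  have bCq : bmfun (fun u => \1_C (q u) : R) := bmfun_comp hq.1.1 bC.
  have [a [ba aE]] := phi_k v.
  (* All other factors come from Q, so the character may be replaced by its conditional expectation.
     What multiplies h is then a function of k, against which 1_B and [del] have the same
     integral. *)
  have red (h : Q -> R) : bmfun h ->
      \int[m]_w (tchar v w.2 * (\1_C w.1 * h (p w))) =
      \int[eta]_u (\1_C (q u) * a (zmap u) * h u).
    move=> bh; transitivity (\int[m]_w ((\1_C (q (p w)) * h (p w)) * tchar v w.2)).
      apply: Rintegral_ae_eq.
      - exact: bmfunM (btc v) (bmfunM bC1 (bmfun_comp hp.1.1 bh)).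
      - exact: bmfunM (bmfun_comp hp.1.1 (bmfunM bCq bh)) (btc v).
      - by move: hqp; apply: filterS => w ->; rewrite mulrC.
    rewrite (phiE v (bmfunM bCq bh)); apply: eq_Rintegral => u _.
    by rewrite aE mulrAC.
  rewrite (red _ bB) (red _ bdelk).
  have ba' : bmfun (fun y : Y * Z => \1_C y.1 * a y.2).
    apply: bmfunM.
      by apply: bmfun_comp bC; exact: measurable_fst.
    by apply: bmfun_comp ba; exact: measurable_snd.
  rewrite (delE _ ba').
  by rewrite -(Rintegral_preserving pk (bmfunM ba' bdel)).
(* Totality of the characters passes from characters to sets of X, with C fixed. *)
have indE C B' : measurable C -> measurable B' ->
    \int[m]_w (\1_B' w.2 * (\1_C w.1 * \1_B (p w))) =
    \int[m]_w (\1_B' w.2 * (\1_C w.1 * del (k (p w)))).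
  move=> mC mB'.
  have bC1 : bmfun (fun w : Y * X => \1_C w.1 : R).
    by apply: bmfun_comp (bmfun_indic R mC); exact: measurable_fst.
  have msnd' : measurable_fun setT (@snd Y X) := measurable_snd.
  have bl := bfunctional_int m msnd' (bmfunM bC1 bBp).
  have bl' := bfunctional_int m msnd' (bmfunM bC1 bdelp).
  have bL := bclosed_eq_bfunctional bl bl'.
  have [_ h] := bclosed_tchar bL
    (fun v => conj (bmfun_tchar R v) (tcharE v C mC)) (bmfun_indic R mB').
  exact: h.
have key : {ae m, forall w, \1_B (p w) = del (k (p w))}.
  apply: (bmfun_ae_eq_setX bBp bdelp) => C B' mC mB'.
  under eq_Rintegral do rewrite mulrAC mulrC.
  rewrite (indE _ _ mC mB'); apply: eq_Rintegral => w _.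
  by rewrite mulrA [_ * \1_C _]mulrC.
(* Along k, [del] is an indicator only almost everywhere; any level strictly between 0 and 1 turns
   it into a set. *)
have mE : measurable [set y | 1 / 2 < del y].
  have := measurable_fun_ltr (measurable_cst (1 / 2 : R)) bdel.1.
  have m1 : measurable [set true] by [].
  by move=> /(_ measurableT _ m1); rewrite setTI.
exists [set y | 1 / 2 < del y] => //.
apply: (ae_preserving_inv hp.1).
  apply: (measurable_iff mB (B := k @^-1` [set y | 1 / 2 < del y])).
  by rewrite -[X in measurable X]setTI; exact: mk.
move: key; apply: filterS => w /= <-; rewrite indicE.
split=> [Bp|]; first by rewrite mem_set//=; lra.
by case: (boolP (p w \in B)); rewrite ?inE//= => _; lra.
Qed.

Lemma intermediate_factor_split :
  exists (d' : measure_display) (Z : measurableType d')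
         (zeta : probability Z R) (b : SL2Z -> Z -> Z) (f : X -> Z),
    [/\ standard_borel R Z, pmp_action zeta b, factor_map mu act zeta b f &
        measurably_conjugate eta c (nu \x zeta)%E (diag_action shift b)].
Proof.
exists _, Z, zeta, b, f.
have [h mh hk] := standard_borel_lift stdQ k_generates.
have kfac : factor_map eta c (nu \x zeta)%E (diag_action shift b) k by split.
have hpres : measure_preserving (nu \x zeta)%E eta h.
  apply: (measure_preserving_factor pk mh).
  have hk' : {ae eta, forall u, id u = (h \o k) u} by move: hk; apply: filterS => u.
  exact: (measure_preserving_ae (measurableT_comp mh mk) hk' (measure_preserving_id eta)).
have mdiag g : measurable_fun setT (diag_action shift b g).
  exact: (measure_preserving_prod (bernoulli_shift_preserving hnu g) (pb g)).1.
split.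
- exact: standard_borel_bool_power.
- by split.
- by split => //; exact: f_equivariant.
- exists k, h; split => //.
  (* Equivariance of h is an equality of measurable maps into the countably separated space Q, so it
     may be checked after composition with k, where h undoes k. *)
  + split => // g; apply: (ae_preserving_inv pk).
      exact: (measurable_eq_fun (standard_borel_separated stdQ)
        (measurableT_comp mh (mdiag g)) (measurableT_comp (hc.2 g).1 mh)).
    have hkc := ae_preserving (hc.2 g) hk.
    move: (k_equivariant g) hkc hk; apply: filterS3 => u h1 h2 h3.
    by rewrite -h1 h2 h3.
  + apply: (ae_preserving_inv pk).
      exact: (measurable_eq_fun sepYZ (measurableT_comp mk mh) (@measurable_id _ _ _)).
    by move: hk; apply: filterS => u ->.
Qed.

End intermediate_factor.

Theorem theorem1p3 (R : realType)
    (nu : probability (power_space SL2Z (circle R)) R)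
    (hnu : is_power_measure (@haar_circle R) nu)
    (d : measure_display) (Q : measurableType d) (stdQ : standard_borel R Q)
    (eta : probability Q R) (c : SL2Z -> Q -> Q)
    (hQ : intermediate_factor
            nu (@bernoulli_shift SL2Z _ (circle R))
            (haar_torus2 R) (@torus2_action R)
            eta c) :
  exists (d' : measure_display) (Z : measurableType d')
         (zeta : probability Z R) (b : SL2Z -> Z -> Z) (f : torus2 R -> Z),
    [/\ standard_borel R Z,
        pmp_action zeta b,
        factor_map (haar_torus2 R) (@torus2_action R) zeta b f &
        measurably_conjugate
          eta c
          (nu \x zeta)%E (diag_action (@bernoulli_shift SL2Z _ (circle R)) b)].
Proof.
case: hQ => hc [p [q [hp hq hqp]]].
exact: (intermediate_factor_split hnu stdQ hc hp hq hqp).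
Qed.
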